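(* Let $1<p<\infty$, $1/p+1/p'=1$, $-\frac1p<\gamma<1-\frac1p$, let $d=(d_n)_{n\ge0}$ be a strictly increasing sequence of positive integers with $d_0=1$, and let $g=(g_k)_{k\ge1}$ be a complex sequence such that $H_{g,\gamma}$ is bounded on $\ell^p$. Then $$\|H_{g,\gamma}\|_{e,\ell^p\to\ell^p}=\|H^*_{g,\gamma}\|_{e,\ell^{p'}\to\ell^{p'}}=\lim_{K\to\infty}\ \sup_{\|a\|_{\ell^p}=1}C_K(|g|;a).$$ In particular, if $1<\liminf_j d_j/d_{j-1}\le\limsup_j d_j/d_{j-1}<\infty$, then $$\|H_{g,\gamma}\|_{e,\ell^p\to\ell^p}=\|H^*_{g,\gamma}\|_{e,\ell^{p'}\to\ell^{p'}}\asymp\limsup_{j\to\infty}G(j;d;g)^{\frac1p},$$ with implied constants independent of $g$.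
   Context: Here $\mathbb N=\{1,2,\dots\}$ and $|g|:=(|g_k|)_{k\ge1}$. For a sequence $g$ and $n\in\mathbb N$, $$G(n;d;g):=\frac1{d_n-d_{n-1}}\sum_{k=d_{n-1}}^{d_n-1}|g_k|^p .$$ The operator $H_{g,\gamma}$ maps $a=(a_n)_{n\ge1}\in\ell^p$ to the sequence whose $k$-th entry ($k\in\mathbb N$) is $$\sum_{n=1}^\infty\left(\frac kn\right)^\gamma\frac{g_k a_n}{n+k};$$ its dual operator $H^*_{g,\gamma}$ maps $b=(b_k)_{k\ge1}\in\ell^{p'}$ to the sequence whose $n$-th entry ($n\in\mathbb N$) is $$\sum_{k=1}^\infty\left(\frac kn\right)^\gamma\frac{g_k b_k}{n+k}.$$ For $K\in\mathbb N$ and $a\in\ell^p$, $$C_K(g;a):=\left(\sum_{k=d_{K-1}}^\infty\left|\sum_{n=1}^\infty\left(\frac kn\right)^\gamma\frac{a_n g_k}{n+k}\right|^p\right)^{\frac1p}.$$ The essential norm of a bounded operator $S\colon\ell^q\to\ell^q$ ($1<q<\infty$) is $\|S\|_{e,\ell^q\to\ell^q}:=\inf_T\|S-T\|_{\ell^q\to\ell^q}$, the infimum being over all compact operators $T\colon\ell^q\to\ell^q$. The notation $X\asymp Y$, with implied constants independent of $g$, means that there are constants $c,C>0$ not depending on $g$ (they may depend on $p,\gamma,d$) with $cY\le X\le CY$. *)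

(* Defs.v *)
From HB Require Import structures.
From mathcomp Require Import all_boot all_order all_algebra.
From mathcomp Require Import all_classical all_reals all_analysis.
From mathcomp Require Import complex.

Set Implicit Arguments.
Unset Strict Implicit.
Unset Printing Implicit Defensive.

Import Order.TTheory GRing.Theory Num.Theory numFieldNormedType.Exports.
Import ComplexField.Normc.

Local Open Scope classical_set_scope.
Local Open Scope complex_scope.
Local Open Scope ring_scope.

(* The topology of R[i] is that of its norm, as for every numFieldType. *)
HB.instance Definition _ (R : realType) := NormedModule.copy R[i] R[i]^o.

(* A complex sequence (x_k)_{k >= 1} is a function nat -> R[i] read at positive
   indices only: everything below that bears on a sequence (norm, equality of
   values, sums) ignores its value at 0. *)

Section SequenceSpaces.
Context {R : realType}.
Implicit Types (q : R) (a b : nat -> R[i]) (S T : (nat -> R[i]) -> nat -> R[i]).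

Definition lpnorm q a : \bar R :=
  ((\sum_(1 <= k <oo) (normc (a k) `^ q)%:E) `^ q^-1)%E.

Definition lp q : set (nat -> R[i]) := [set a | (lpnorm q a < +oo)%E].

Definition linear_on_lp q T : Prop :=
  (forall a, lp q a -> lp q (T a)) /\
  (forall (c : R[i]) a b, lp q a -> lp q b ->
    forall k, (0 < k)%N -> T (fun n => c * a n + b n) k = c * T a k + T b k).

Definition bounded_on_lp q T : Prop :=
  linear_on_lp q T /\
  exists M : R, forall a, lp q a -> (lpnorm q (T a) <= M%:E * lpnorm q a)%E.

(* T maps every norm-bounded sequence (u m)_m of l^q to a sequence that has a
   subsequence converging in l^q. *)
Definition compact_on_lp q T : Prop :=
  linear_on_lp q T /\
  forall u : nat -> nat -> R[i],
    (exists M : R, forall m, (lpnorm q (u m) <= M%:E)%E) ->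
    exists phi : nat -> nat, {homo phi : m n / (m < n)%N} /\
      exists2 b, lp q b &
        (fun m => lpnorm q (T (u (phi m)) \- b)) @ \oo --> 0%E.

Definition opnorm q S : \bar R :=
  ereal_sup [set lpnorm q (S a) | a in [set a | (lpnorm q a <= 1)%E]].

Definition essnorm q S : \bar R :=
  ereal_inf [set opnorm q (fun a => S a \- T a) | T in compact_on_lp q].

End SequenceSpaces.

Section HilbertOperator.
Context {R : realType}.
Implicit Types (p gamma : R) (d : nat -> nat) (g a b : nat -> R[i]).

(* lim is a total function, but the two series below converge wherever they are
   used: for Hop by Hoelder's inequality, as a \in l^p and gamma > - 1/p; for
   Hdual by duality, once Hop g gamma is bounded on l^p. *)
Definition Hop g gamma a (k : nat) : R[i] :=
  \big[+%R/0]_(1 <= n <oo)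
    (((k%:R / n%:R) `^ gamma)%:C * (g k * a n / (n + k)%:R)).

Definition Hdual g gamma b (n : nat) : R[i] :=
  \big[+%R/0]_(1 <= k <oo)
    (((k%:R / n%:R) `^ gamma)%:C * (g k * b k / (n + k)%:R)).

Definition Ctail p gamma d (K : nat) g a : \bar R :=
  ((\sum_(d K.-1 <= k <oo) (normc (Hop g gamma a k) `^ p)%:E) `^ p^-1)%E.

Definition absseq g : nat -> R[i] := fun k => `|g k|.

Definition Gmean p d g (n : nat) : R :=
  (d n - d n.-1)%:R^-1 * \sum_(d n.-1 <= k < d n) normc (g k) `^ p.

End HilbertOperator.

(* Main.v *)
(* Both operators have entries of constant phase along rows or columns, so
   their norms are those of nonnegative matrices, and these are governed by one
   bilinear form on finitely supported vectors, which is symmetric under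
   transposition.  Cutting off the rows k < d_(K-1) is a finite-rank
   perturbation of H and of its dual, so both essential norms are at most the
   norm S_K of the remaining tail.  Conversely, if T is compact, the tails of
   T a tend to 0 uniformly on the unit ball, and T is uniformly small on unit
   vectors supported far out (a gliding hump: N disjoint unit blocks add up to
   a vector of norm at most N^(1/q), while their images would add up to size N).
   Hence both essential norms equal inf S_K = lim S_K.

   In the lacunary case the kernel (k/n)^gamma / (n+k) is, up to constants,
   independent of k within a block [d_(j-1), d_j).  So g can be replaced by its
   p-th mean over the block, and the upper bound follows from the boundedness
   of the kernel itself (Schur test with powers); the lower bound is obtained
   by testing on the normalized indicators of the blocks. *)

Require Import Defs.
From HB Require Import structures.
From mathcomp Require Import all_boot all_order all_algebra.
From mathcomp Require Import all_classical all_reals all_analysis.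
From mathcomp Require Import complex ring lra.
Import Order.TTheory GRing.Theory Num.Theory numFieldNormedType.Exports.
Import ComplexField.Normc.
Set Implicit Arguments.
Unset Strict Implicit.
Unset Printing Implicit Defensive.
Local Open Scope classical_set_scope.
Local Open Scope ring_scope.

(** * Finite Hoelder duality *)

(** The cut [k >= D] acts on the output of [Hop] but on the input of [Hdual], so the two lower
    bounds need different properties of a compact [T]: small output tails for the one, smallness on
    inputs supported far out for the other. The second is proved directly on l^p', so neither
    Schauder's theorem nor the dual space of l^p is needed. [matnorm_le] speaks of finite sums only;
    a bound in this form passes to infinite series through [opmx_cvg] and [opmx_le], and is
    recovered from an operator by testing on finitely supported vectors. In particular the series of
    [Hdual], whose convergence is not evident from its definition, converges by the transposed form
    bound. In the lacunary part the range of [gamma] says exactly that [gamma + 1/p] and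
    [1 - (gamma + 1/p)] both lie in (0,1), which makes the kernel bounded. The constants depend only
    on the exponents and on bounds for the ratios [d_j / d_(j-1)], and are fixed before [g]. *)

Section FiniteSums.
Context {R : realType}.
Implicit Types (p q M : R) (f h : nat -> R) (N : nat).

Lemma powR_leM p (x M : R) : 0 < p -> 0 <= x -> 0 <= M ->
  (x `^ p <= M `^ p) = (x <= M).
Proof.
move=> p0 x0 M0; apply/idP/idP => [|xM]; last first.
  by apply: ge0_ler_powR => //; exact: ltW.
by rewrite leNgt => xM; rewrite leNgt; apply: contra xM => /gt0_ltr_powR; apply.
Qed.

Lemma powRK p (x : R) : p != 0 -> 0 <= x -> (x `^ p) `^ p^-1 = x.
Proof. by move=> p0 x0; rewrite -powRrM mulfV// powRr1. Qed.

Lemma powRVK p (x : R) : p != 0 -> 0 <= x -> (x `^ p^-1) `^ p = x.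
Proof. by move=> p0 x0; rewrite -powRrM mulVf// powRr1. Qed.

Lemma powR_div p (x y : R) : 0 <= x -> 0 <= y -> (x / y) `^ p = x `^ p / y `^ p.
Proof.
move=> x0 y0; rewrite powRM ?invr_ge0// -powR_inv1// powRAC.
by rewrite powR_inv1 ?powR_ge0.
Qed.

(** This is the degenerate case of the norm bounds below, where one cannot normalise by dividing by
    the bound. *)
Lemma sum_powR_le0 p m N f : 0 < p ->
  \sum_(m <= k < N) f k `^ p <= 0 `^ p ->
  forall k, (m <= k < N)%N -> f k = 0.
Proof.
move=> p0 f0 k mkN; apply/(@powR_eq0_eq0 _ _ p)/eqP.
have : \sum_(m <= k < N) f k `^ p == 0.
  rewrite eq_le sumr_ge0 ?andbT; last by move=> *; exact: powR_ge0.
  by apply: (le_trans f0); rewrite powR0// gt_eqF.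
rewrite psumr_eq0; last by move=> *; exact: powR_ge0.
by move/allP => /(_ k); rewrite mem_index_iota mkN => /(_ isT).
Qed.

(** After dividing [f] by [M], Young's inequality term by term bounds the sum by [1/p + 1/q = 1]. *)
Lemma holder_nat p q m N f h M : 0 < p -> 0 < q -> p^-1 + q^-1 = 1 ->
  (forall k, 0 <= f k) -> (forall k, 0 <= h k) -> 0 <= M ->
  \sum_(m <= k < N) f k `^ p <= M `^ p ->
  \sum_(m <= k < N) h k `^ q <= 1 ->
  \sum_(m <= k < N) f k * h k <= M.
Proof.
move=> p0 q0 pq f0 h0; rewrite le_eqVlt => /predU1P[<-|M0] fM h1.
  have f_0 := sum_powR_le0 p0 fM.
  by rewrite big_nat big1// => k /f_0 ->; rewrite mul0r.
rewrite -[leRHS]mul1r -ler_pdivrMr//.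
have -> : (\sum_(m <= k < N) f k * h k) / M = \sum_(m <= k < N) (f k / M) * h k.
  by rewrite mulr_suml; apply: eq_bigr => k _; rewrite mulrAC.
apply: (@le_trans _ _
  (\sum_(m <= k < N) ((f k / M) `^ p / p + h k `^ q / q))).
  apply: ler_sum => k _; apply: conjugate_powR => //.
  by rewrite divr_ge0// ltW.
rewrite big_split/= -!mulr_suml -pq lerD//.
  rewrite ler_piMl ?invr_ge0 ?(ltW p0)//.
  have -> : \sum_(m <= k < N) (f k / M) `^ p =
      (\sum_(m <= k < N) f k `^ p) / M `^ p.
    rewrite mulr_suml; apply: eq_bigr => k _.
    by rewrite powR_div// ltW.
  by rewrite ler_pdivrMr ?powR_gt0// mul1r.
by rewrite ler_piMl// invr_ge0 ltW.
Qed.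

Lemma holder_nat_converse p q m N f M : 0 < p -> 0 < q -> p^-1 + q^-1 = 1 ->
  (forall k, 0 <= f k) -> 0 <= M ->
  (forall h, (forall k, 0 <= h k) -> \sum_(m <= k < N) h k `^ q <= 1 ->
    \sum_(m <= k < N) f k * h k <= M) ->
  \sum_(m <= k < N) f k `^ p <= M `^ p.
Proof.
move=> p0 q0 pq f0 M0 fM; set S := \sum_(m <= k < N) _.
have : 0 <= S by apply: sumr_ge0 => *; exact: powR_ge0.
rewrite le_eqVlt => /predU1P[<-|S0]; first exact: powR_ge0.
have pn : p != 0 by rewrite gt_eqF.
have qn : q != 0 by rewrite gt_eqF.
have p1q : (p - 1) * q = p.
  rewrite (_ : p - 1 = p * q^-1) ?mulfVK//.
  by rewrite (_ : q^-1 = 1 - p^-1) ?mulrBr ?mulr1 ?mulfV// -pq addrC addKr.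
(* The extremal vector of Hoelder's inequality: since [(p - 1) q = p], its q-th powers sum to
   [S * S^-1 = 1], and its pairing with [f] is [S^(1 - 1/q) = S^(1/p)]. *)
have Sf := fM (fun k => f k `^ (p - 1) * S `^ (- q^-1)).
rewrite -(@powRVK p S) ?(ltW S0)// powR_leM ?powR_ge0//.
have <- : \sum_(m <= k < N) f k * (f k `^ (p - 1) * S `^ (- q^-1)) = S `^ p^-1.
  transitivity (S `^ 1 * S `^ (- q^-1)).
    rewrite powRr1 ?(ltW S0)// mulr_suml; apply: eq_bigr => k _.
    rewrite mulrA; congr (_ * _); have [->|fk] := eqVneq (f k) 0.
      by rewrite mul0r powR0.
    rewrite -{1}[f k]powRr1// -powRD; last by rewrite fk implybT.
    by rewrite addrC subrK.
  by rewrite -powRD ?(gt_eqF S0) ?implybT// -pq addrK.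
apply: Sf => [k|]; first by rewrite mulr_ge0 ?powR_ge0.
rewrite (_ : \sum_(_ <= k < _) _ = S * S^-1); first by rewrite divff ?gt_eqF.
rewrite {1}/S mulr_suml; apply: eq_bigr => k _.
rewrite powRM ?powR_ge0// -!powRrM p1q mulNr mulVf//.
by rewrite powR_inv1 ?(ltW S0).
Qed.

(** By duality it suffices to pair with a fixed unit vector [u], and the pairing is additive in the
    other argument. *)
Lemma minkowski_nat p m N f h A B : 1 < p ->
  (forall k, 0 <= f k) -> (forall k, 0 <= h k) -> 0 <= A -> 0 <= B ->
  \sum_(m <= k < N) f k `^ p <= A `^ p ->
  \sum_(m <= k < N) h k `^ p <= B `^ p ->
  \sum_(m <= k < N) (f k + h k) `^ p <= (A + B) `^ p.
Proof.
move=> p1 f0 h0 A0 B0 fA hB.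
have p0 : 0 < p by apply: lt_trans p1.
have q0 : 0 < (1 - p^-1)^-1 by rewrite invr_gt0 subr_gt0 invf_lt1.
have pq : p^-1 + ((1 - p^-1)^-1)^-1 = 1 by rewrite invrK addrC subrK.
apply: (holder_nat_converse p0 q0 pq) => [k||u u0 u1]; rewrite ?addr_ge0//.
under eq_bigr do rewrite mulrDl.
rewrite big_split lerD//=.
  exact: (holder_nat p0 q0 pq).
exact: (holder_nat p0 q0 pq).
Qed.

(* Being symmetric under transposition, this is the form in which the norm bound
   passes from [Hop] to [Hdual]. *)
Definition matnorm_le p q (kap : nat -> nat -> R) M := forall N f h,
  (forall n, 0 <= f n) -> (forall k, 0 <= h k) ->
  \sum_(1 <= n < N) f n `^ p <= 1 -> \sum_(1 <= k < N) h k `^ q <= 1 ->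
  \sum_(1 <= k < N) (\sum_(1 <= n < N) kap n k * f n) * h k <= M.

Lemma matnorm_le_tr p q kap M :
  matnorm_le p q kap M -> matnorm_le q p (fun k n => kap n k) M.
Proof.
move=> kM N h f h0 f0 h1 f1; apply: le_trans (kM N f h f0 h0 f1 h1).
under eq_bigr do rewrite mulr_suml.
rewrite exchange_big/=; apply: ler_sum => k _.
by rewrite mulr_suml; apply: ler_sum => n _; rewrite mulrAC.
Qed.

Lemma matnorm_le_image p q kap M N f : 0 < p -> 0 < q -> p^-1 + q^-1 = 1 ->
  (forall n k, 0 <= kap n k) -> 0 <= M -> matnorm_le p q kap M ->
  (forall n, 0 <= f n) -> \sum_(1 <= n < N) f n `^ p <= 1 ->
  \sum_(1 <= k < N) (\sum_(1 <= n < N) kap n k * f n) `^ p <= M `^ p.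
Proof.
move=> p0 q0 pq kap0 M0 kM f0 f1.
apply: (holder_nat_converse p0 q0 pq) => [k||h h0 h1] //.
  by apply: sumr_ge0 => *; rewrite mulr_ge0.
exact: kM.
Qed.

Lemma matnorm_le_image_scaled p q kap M A N f :
  0 < p -> 0 < q -> p^-1 + q^-1 = 1 ->
  (forall n k, 0 <= kap n k) -> 0 <= M -> matnorm_le p q kap M -> 0 <= A ->
  (forall n, 0 <= f n) -> \sum_(1 <= n < N) f n `^ p <= A `^ p ->
  \sum_(1 <= k < N) (\sum_(1 <= n < N) kap n k * f n) `^ p <= (M * A) `^ p.
Proof.
move=> p0 q0 pq kap0 M0 kM; rewrite le_eqVlt => /predU1P[<- f0 fA|A0 f0 fA].
  have f_0 := sum_powR_le0 p0 fA.
  rewrite mulr0 powR0 ?gt_eqF// big1// => k _.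
  rewrite big_nat big1 ?powR0 ?gt_eqF// => n /f_0 ->; exact: mulr0.
have /(matnorm_le_image p0 q0 pq kap0 M0 kM) : forall n, 0 <= f n / A.
  by move=> n; rewrite divr_ge0// ltW.
move=> /(_ N); under eq_bigr do rewrite powR_div ?(ltW A0)//.
rewrite -mulr_suml ler_pdivrMr ?powR_gt0// mul1r => /(_ fA).
under eq_bigr => k _.
  under eq_bigr do rewrite mulrA.
  rewrite -mulr_suml powR_div ?(ltW A0)//; last first.
    by apply: sumr_ge0 => *; rewrite mulr_ge0.
  over.
by rewrite -mulr_suml powRM ?(ltW A0)// ler_pdivrMr ?powR_gt0.
Qed.

Lemma matnorm_le_of_image p q kap M : 0 < p -> 0 < q -> p^-1 + q^-1 = 1 ->
  (forall n k, 0 <= kap n k) -> 0 <= M ->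
  (forall N f, (forall n, 0 <= f n) -> \sum_(1 <= n < N) f n `^ p <= 1 ->
    \sum_(1 <= k < N) (\sum_(1 <= n < N) kap n k * f n) `^ p <= M `^ p) ->
  matnorm_le p q kap M.
Proof.
move=> p0 q0 pq kap0 M0 kM N f h f0 h0 f1 h1.
apply: (holder_nat p0 q0 pq) => // [k|]; last exact: kM.
by apply: sumr_ge0 => *; rewrite mulr_ge0.
Qed.

End FiniteSums.

(** * The norm of l^q *)

Lemma normc_ge0 (R : realType) (x : R[i]) : 0 <= normc x.
Proof. by case: x => a b; exact: sqrtr_ge0. Qed.

Lemma normcE_norm (R : realType) (x : R[i]) : `|x| = (normc x)%:C%C.
Proof. by case: x => a b; rewrite normc_def. Qed.

Lemma normc_real (R : realType) (x : R) : 0 <= x -> normc (x%:C)%C = x.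
Proof. by move=> x0; rewrite /normc/= expr0n/= addr0 sqrtr_sqr ger0_norm. Qed.

Section LpNorm.
Context {R : realType}.
Implicit Types (q M : R) (a b : nat -> R[i]) (N : nat).

Lemma nneseries_leP m (u : nat -> R) M : (forall k, 0 <= u k) ->
  (\sum_(m <= k <oo) (u k)%:E <= M%:E)%E <->
  (forall N, \sum_(m <= k < N) u k <= M).
Proof.
move=> u0; split=> [uM N|uM].
  rewrite -lee_fin -sumEFin; apply: le_trans uM.
  by apply: nneseries_lim_ge => n _ _; rewrite lee_fin ?powR_ge0.
apply: lime_le; first by apply: is_cvg_nneseries => n _ _; rewrite lee_fin ?powR_ge0.
by apply: nearW => N; rewrite sumEFin lee_fin.
Qed.

Lemma poweR_leP q (S : \bar R) M : 0 < q -> 0 <= M -> (0 <= S)%E ->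
  (S `^ q^-1 <= M%:E)%E = (S <= (M `^ q)%:E)%E.
Proof.
move=> q0 M0; case: S => [s| |] //= s0; last by rewrite gt_eqF ?invr_gt0.
have s0' : 0 <= s by rewrite lee_fin in s0.
rewrite !lee_fin -[in RHS](@powRVK _ q s) ?gt_eqF//.
by rewrite powR_leM ?powR_ge0.
Qed.

Lemma lpnorm_leP q a M : 0 < q -> 0 <= M ->
  (lpnorm q a <= M%:E)%E <->
  (forall N, \sum_(1 <= k < N) normc (a k) `^ q <= M `^ q).
Proof.
move=> q0 M0; rewrite /lpnorm poweR_leP//; last first.
  by apply: nneseries_ge0 => n _ _; rewrite lee_fin powR_ge0.
by apply: (@nneseries_leP 1) => k; exact: powR_ge0.
Qed.

Lemma lpnorm_ge0 q a : (0 <= lpnorm q a)%E.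
Proof. exact: poweR_ge0. Qed.

Lemma lp_fineE q a : lp q a ->
  exists2 M : R, 0 <= M & lpnorm q a = M%:E.
Proof.
rewrite /lp/=; have := lpnorm_ge0 q a; case: (lpnorm q a) => [M| |]// M0 _.
by exists M.
Qed.

Lemma le_lpnorm q a b : 0 < q ->
  (forall k, (0 < k)%N -> normc (a k) <= normc (b k)) ->
  (lpnorm q a <= lpnorm q b)%E.
Proof.
move=> q0 ab; have := lpnorm_ge0 q b.
case E: (lpnorm q b) => [M| |] // M0; last by rewrite leey.
apply/lpnorm_leP => // N.
have /lpnorm_leP bM : (lpnorm q b <= M%:E)%E by rewrite E.
apply: le_trans (bM _ _ N) => //; rewrite big_nat [leRHS]big_nat.
apply: ler_sum => k /andP[k0 _]; rewrite powR_leM ?normc_ge0//; exact: ab.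
Qed.

Lemma eq_lpnorm q a b : 0 < q -> (forall k, (0 < k)%N -> a k = b k) ->
  lpnorm q a = lpnorm q b.
Proof.
by move=> q0 ab; apply/eqP; rewrite eq_le !le_lpnorm// => k k0; rewrite ab.
Qed.

Lemma lpnormD q a b : 1 < q ->
  (lpnorm q (fun k => (a k + b k)%R) <= lpnorm q a + lpnorm q b)%E.
Proof.
move=> q1; have q0 : 0 < q by apply: lt_trans q1.
have := lpnorm_ge0 q a; have := lpnorm_ge0 q b.
case Ea: (lpnorm q a) => [A| |] //; last first.
  by case Eb: (lpnorm q b) => [B| |] // _ _; rewrite leey.
case Eb: (lpnorm q b) => [B| |] // B0 A0; last by rewrite leey.
apply/lpnorm_leP => //; first by rewrite addr_ge0.
move=> N; apply: (@le_trans _ _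
  (\sum_(1 <= k < N) (normc (a k) + normc (b k)) `^ q)).
  apply: ler_sum => k _; rewrite powR_leM ?addr_ge0 ?normc_ge0//; exact: le_normcD.
apply: minkowski_nat => // [k|k||]; rewrite ?normc_ge0//.
  by move: N; apply/lpnorm_leP => //; rewrite Ea.
by move: N; apply/lpnorm_leP => //; rewrite Eb.
Qed.

Lemma lpnormZ_le q (c : R[i]) a : 0 < q ->
  (lpnorm q (fun k => (c * a k)%R) <= (normc c)%:E * lpnorm q a)%E.
Proof.
move=> q0; have := lpnorm_ge0 q a; case E: (lpnorm q a) => [A| |] // A0.
  apply/lpnorm_leP => //; first by rewrite mulr_ge0 ?normc_ge0.
  move=> N; rewrite powRM ?normc_ge0//.
  have /lpnorm_leP aA : (lpnorm q a <= A%:E)%E by rewrite E.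
  apply: le_trans (ler_wpM2l (powR_ge0 _ _) (aA q0 A0 N)).
  by rewrite mulr_sumr ler_sum// => k _; rewrite normcM powRM ?normc_ge0.
have [->|c0] := eqVneq c 0; last first.
  rewrite gt0_muley ?leey// lte_fin lt_neqAle normc_ge0 andbT eq_sym.
  by apply: contra c0 => /eqP/eq0_normc ->.
rewrite normc0 mul0e; apply/lpnorm_leP => // N.
by rewrite big1 ?powR_ge0// => k _; rewrite mul0r normc0 powR0 ?gt_eqF.
Qed.

Lemma lpnormZ q (c : R[i]) a : 0 < q ->
  lpnorm q (fun k => c * a k) = ((normc c)%:E * lpnorm q a)%E.
Proof.
move=> q0; apply/eqP; rewrite eq_le lpnormZ_le//=.
have [->|c0] := eqVneq c 0; first by rewrite normc0 mul0e lpnorm_ge0.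
have nc0 : 0 < normc c.
  rewrite lt_neqAle normc_ge0 andbT eq_sym.
  by apply: contra c0 => /eqP/eq0_normc ->.
rewrite -lee_pdivlMl//.
have := lpnormZ_le c^-1 (fun k => c * a k) q0; rewrite normcV.
apply: le_trans; apply: le_lpnorm => // k _.
by rewrite mulrA mulVf// mul1r.
Qed.

Lemma normc_le_lpnorm q a k : 0 < q -> (0 < k)%N ->
  ((normc (a k))%:E <= lpnorm q a)%E.
Proof.
move=> q0 k0; have := lpnorm_ge0 q a.
case E: (lpnorm q a) => [A| |] // A0; last by rewrite leey.
have /lpnorm_leP aA : (lpnorm q a <= A%:E)%E by rewrite E.
have := aA q0 A0 k.+1; rewrite big_nat_recr//= => kA.
rewrite lee_fin -(@powR_leM _ q) ?normc_ge0//; apply: le_trans kA.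
by rewrite lerDr sumr_ge0// => *; rewrite powR_ge0.
Qed.

Lemma lpnorm_finsupp q a N : 0 < q -> (forall k, (N <= k)%N -> a k = 0) ->
  lpnorm q a = ((\sum_(1 <= k < N) normc (a k) `^ q) `^ q^-1)%:E.
Proof.
move=> q0 aN; rewrite /lpnorm -poweR_EFin; congr (_ `^ _)%E.
apply/lim_near_cst => //; exists N => // n /= Nn; rewrite sumEFin; congr _%:E.
have [N0|N1] := posnP N.
  rewrite N0 [RHS]big_geq// big1// => k _.
  by rewrite aN ?N0// normc0 powR0 ?gt_eqF.
rewrite (big_cat_nat N1 Nn)/= [X in _ + X]big_nat [X in _ + X]big1 ?addr0//.
by move=> k /andP[Nk _]; rewrite aN// normc0 powR0 ?gt_eqF.
Qed.

Lemma lp_finsupp q a N : 0 < q -> (forall k, (N <= k)%N -> a k = 0) -> lp q a.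
Proof. by move=> q0 /(lpnorm_finsupp q0); rewrite /lp /= => ->; rewrite ltry. Qed.

Definition seqtail N a : nat -> R[i] := fun k => if (N <= k)%N then a k else 0.

Lemma lpnorm_seqtail q N a : 0 < q -> (0 < N)%N ->
  lpnorm q (seqtail N a) =
  ((\sum_(N <= k <oo) (normc (a k) `^ q)%:E) `^ q^-1)%E.
Proof.
move=> q0 N0; rewrite /lpnorm; congr (_ `^ _)%E.
have -> := @nneseries_split R (fun k => (normc (seqtail N a k) `^ q)%:E) 1 N.-1.
  2: by move=> *; rewrite lee_fin powR_ge0.
rewrite add1n prednK// big_nat big1 ?add0e; last first.
  move=> k /andP[_ kN]; rewrite /seqtail leqNgt kN normc0 powR0 ?gt_eqF//.
congr (limn _); apply/funext => n; apply: eq_big_nat => k /andP[Nk _].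
by rewrite /seqtail Nk.
Qed.

(** The partial sums of the q-th powers increase to a finite limit; [N] is an index from which they
    are within [e^q] of it. *)
Lemma lpnorm_seqtail_small q a (e : R) : 0 < q -> 0 < e -> lp q a ->
  exists N, (lpnorm q (seqtail N a) <= e%:E)%E.
Proof.
move=> q0 e0 /lp_fineE[A A0 EA].
have /lpnorm_leP aA : (lpnorm q a <= A%:E)%E by rewrite EA.
have {aA} := aA q0 A0 => aA.
pose s N := \sum_(1 <= k < N) normc (a k) `^ q.
have s_ge m n : (m <= n)%N -> s m <= s n.
  move=> mn; rewrite /s; have [m0|m1] := posnP m.
    by rewrite m0 [leLHS]big_geq// sumr_ge0// => *; rewrite powR_ge0.
  by rewrite (big_cat_nat m1 mn)/= lerDl sumr_ge0// => *; rewrite powR_ge0.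
have cs : cvgn s.
  by apply: nondecreasing_is_cvgn => //; exists (A `^ q) => _ [N _ <-]; exact: aA.
have [N N1 sN] : exists2 N, (0 < N)%N & limn s - s N <= e `^ q.
  have /cvgrPdist_le/(_ _ (powR_gt0 q e0))[N _ sN] := cs.
  by exists N.+1 => //; apply: le_trans (ler_norm _) (sN _ _) => /=.
exists N; apply/lpnorm_leP => //; first exact: ltW.
move=> n; apply: le_trans sN; rewrite lerBrDl.
apply: le_trans (nondecreasing_cvgn_le s_ge cs (maxn N n)).
rewrite {2}/s (big_cat_nat N1 (leq_maxl N n))/= lerD2l.
have [nN|Nn] := leqP n N.
  rewrite [leLHS]big_nat big1 => [|k /andP[_ kn]].
    by rewrite sumr_ge0// => *; rewrite powR_ge0.
  by rewrite /seqtail leqNgt (leq_trans kn nN) normc0 powR0 ?gt_eqF.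
rewrite (big_cat_nat N1 (ltnW Nn))/=.
rewrite [X in X + _]big_nat big1 ?add0r => [|k /andP[_ kn]]; last first.
  by rewrite /seqtail leqNgt kn normc0 powR0 ?gt_eqF.
rewrite le_eqVlt; apply/orP; left; apply/eqP.
by apply: eq_big_nat => k /andP[Nk _]; rewrite /seqtail Nk.
Qed.

End LpNorm.

(** * Operators given by complex matrices *)

Section ComplexMatrices.
Local Notation Re := complex.Re.
Local Notation Im := complex.Im.
Context {R : realType}.
Lemma cvgc_normcP (u : nat -> R[i]) (l : R[i]) :
  u @ \oo --> l <->
  (forall e : R, 0 < e -> \forall n \near \oo, normc (l - u n) < e).
Proof.
split=> [/cvgrPdist_lt ul e e0|ul].
  have := ul (e%:C)%C; rewrite ltcR => /(_ e0); apply: filterS => n.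
  by rewrite normcE_norm ltcR.
apply/cvgrPdist_lt => e e0.
have Ime : Im e = 0 by apply: ger0_Im; exact: ltW.
have Ee : e = (Re e)%:C%C by rewrite {1}[e]complexE Ime mulr0 addr0.
have Ree : 0 < Re e by rewrite -ltcR -Ee.
have := ul _ Ree; apply: filterS => n.
by rewrite normcE_norm Ee ltcR.
Qed.

Lemma Re_le_normc (x : R[i]) : `|Re x| <= normc x.
Proof. by have := normc_ge_Re x; rewrite normcE_norm lecR. Qed.

Lemma Im_le_normc (x : R[i]) : `|Im x| <= normc x.
Proof.
case: x => a b; rewrite /normc/= -[leLHS]sqrtr_sqr ler_wsqrtr//.
by rewrite lerDr sqr_ge0.
Qed.

Lemma normc_le_ReIm (x : R[i]) : normc x <= `|Re x| + `|Im x|.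
Proof.
case: x => a b; rewrite /normc/= -(@ler_pXn2r _ 2) ?nnegrE ?addr_ge0 ?sqrtr_ge0//.
rewrite sqr_sqrtr ?addr_ge0 ?sqr_ge0// sqrrD !real_normK ?num_real//.
by rewrite lerD2r lerDl mulrn_wge0// mulr_ge0.
Qed.

Lemma Re_sum (I : Type) (r : seq I) (P : pred I) (F : I -> R[i]) :
  Re (\sum_(i <- r | P i) F i) = \sum_(i <- r | P i) Re (F i).
Proof. by apply: (big_morph (@Re R)) => // -[a b] [c e]. Qed.

Lemma Im_sum (I : Type) (r : seq I) (P : pred I) (F : I -> R[i]) :
  Im (\sum_(i <- r | P i) F i) = \sum_(i <- r | P i) Im (F i).
Proof. by apply: (big_morph (@Im R)) => // -[a b] [c e]. Qed.

Lemma normc_sum (I : Type) (r : seq I) (P : pred I) (F : I -> R[i]) :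
  normc (\sum_(i <- r | P i) F i) <= \sum_(i <- r | P i) normc (F i).
Proof.
elim/big_ind2 : _ => //; first by rewrite normc0.
by move=> x y u v xy uv; apply: le_trans (le_normcD _ _) _; rewrite lerD.
Qed.

Lemma cvgc_ReIm (u : nat -> R[i]) (x y : R) :
  Re (u n) @[n --> \oo] --> x -> Im (u n) @[n --> \oo] --> y ->
  u @ \oo --> (x +i* y)%C.
Proof.
move=> ux uy; apply/cvgc_normcP => e e0.
have e2 : 0 < e / 2 by rewrite divr_gt0.
have /cvgrPdist_lt/(_ _ e2) ux' := ux.
have /cvgrPdist_lt/(_ _ e2) uy' := uy.
near=> n; rewrite (splitr e); apply: le_lt_trans (normc_le_ReIm _) _.
rewrite ltrD//.
  by rewrite (_ : Re _ = x - Re (u n)); [near: n|case: (u n)].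
by rewrite (_ : Im _ = y - Im (u n)); [near: n|case: (u n)].
Unshelve. all: by end_near. Qed.

Lemma abs_cvg_series (u : nat -> R) (B : R) m :
  (forall N, \sum_(m <= n < N) `|u n| <= B) ->
  cvgn (fun N => \sum_(m <= n < N) u n).
Proof.
move=> uB; suff : cvgn (series u) by rewrite -(is_cvg_series_restrict m).
apply: normed_cvg; rewrite -(is_cvg_series_restrict m).
apply: nondecreasing_is_cvgn; last by exists B => _ [N _ <-]; exact: uB.
move=> i j ij /=; have [im|mi] := leqP i m.
  by rewrite [leLHS]big_geq// sumr_ge0.
by rewrite (big_cat_nat (ltnW mi) ij)/= lerDl sumr_ge0.
Qed.

Lemma abs_cvgc_series (u : nat -> R[i]) (B : R) m :
  (forall N, \sum_(m <= n < N) normc (u n) <= B) ->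
  cvgn (fun N => \sum_(m <= n < N) u n).
Proof.
move=> uB.
have /abs_cvg_series/cvg_ex[x ux] : forall N, \sum_(m <= n < N) `|Re (u n)| <= B.
  by move=> N; apply: le_trans (uB N); apply: ler_sum => n _; exact: Re_le_normc.
have /abs_cvg_series/cvg_ex[y uy] : forall N, \sum_(m <= n < N) `|Im (u n)| <= B.
  by move=> N; apply: le_trans (uB N); apply: ler_sum => n _; exact: Im_le_normc.
apply/cvg_ex; exists (x +i* y)%C; apply: cvgc_ReIm.
  by under eq_fun do rewrite Re_sum.
by under eq_fun do rewrite Im_sum.
Qed.

Lemma cvg_sum_nat m N (f : nat -> nat -> R) (l : nat -> R) :
  (forall k, (m <= k < N)%N -> f k n @[n --> \oo] --> l k) ->
  \sum_(m <= k < N) f k n @[n --> \oo] --> \sum_(m <= k < N) l k.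
Proof.
elim: N => [|N IH] fl.
  by rewrite big_geq//; under eq_fun do rewrite big_geq//; exact: cvg_cst.
have [Nm|mN] := ltnP N m.
  by rewrite big_geq//; under eq_fun do rewrite big_geq//; exact: cvg_cst.
rewrite big_nat_recr//; under eq_fun do rewrite big_nat_recr//.
apply: cvgD; last by apply: fl; rewrite mN/=.
by apply: IH => k /andP[mk kN]; apply: fl; rewrite mk ltnW.
Qed.

Lemma cvgc_normc (u : nat -> R[i]) l : u @ \oo --> l ->
  normc (u n) @[n --> \oo] --> normc l.
Proof.
move=> /cvgc_normcP ul; apply/cvgrPdist_lt => e e0.
apply: filterS (ul e e0) => n; apply: le_lt_trans.
have lu : normc l <= normc (l - u n) + normc (u n).
  by rewrite -[in leLHS](subrK (u n) l) le_normcD.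
have ul' : normc (u n) <= normc (l - u n) + normc l.
  by rewrite -[in leLHS](subrK l (u n)) -(normcN (l - u n)) opprB le_normcD.
by rewrite ler_norml; apply/andP; split; lra.
Qed.

Lemma bolzano_weierstrass_complex (u : nat -> R[i]) (B : R) :
  (forall n, normc (u n) <= B) ->
  exists2 phi : nat -> nat, {homo phi : m n / (m < n)%N} & cvgn (u \o phi).
Proof.
have bnd (v : nat -> R) : (forall n, `|v n| <= B) ->
    exists2 f : nat -> nat, {homo f : m n / (m < n)%N} & cvgn (v \o f).
  move=> vB; have /bolzano_weierstrass[f fincr fv] : bounded_fun v.
    exists B; split; first exact: num_real.
    by move=> y By n _; apply: le_trans (vB n) (ltW By).
  by exists f => // m n mn; have := leW_mono fincr m n; rewrite !ltEnat/= => ->.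
move=> uB.
have [f fincr fu] := bnd (@Re R \o u) (fun n => le_trans (Re_le_normc _) (uB n)).
have [h hincr hu] := bnd (@Im R \o u \o f) (fun n => le_trans (Im_le_normc _) (uB _)).
exists (f \o h) => [m n mn|]; first by apply: fincr; exact: hincr.
move/cvg_ex : fu => [x ux]; move/cvg_ex : hu => [y uy].
apply/cvg_ex; exists (x +i* y)%C; apply: cvgc_ReIm uy.
have -> : (fun n => Re ((u \o (f \o h)) n)) = (@Re R \o u \o f) \o h by [].
apply: cvg_comp ux; apply/cvgnyPge => n.
exists n => // k /= nk; apply: leq_trans nk _.
by elim: k => // k IH; apply: leq_ltn_trans IH _; exact: hincr.
Qed.

(** Columns come first: [n] is the input index and [k] the output index, so that the transpose is a
    mere swap of arguments. On finitely supported vectors the value is a finite sum, without any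
    convergence hypothesis. *)
Definition opmx (z : nat -> nat -> R[i]) (a : nat -> R[i]) (k : nat) : R[i] :=
  \big[+%R/0]_(1 <= n <oo) (z n k * a n).

Implicit Types (z : nat -> nat -> R[i]) (a b : nat -> R[i]).

Lemma opmx_finsupp z a N k : (forall n, (N <= n)%N -> a n = 0) ->
  opmx z a k = \sum_(1 <= n < N) z n k * a n.
Proof.
move=> aN; apply/lim_near_cst; first exact: norm_hausdorff.
exists N => // m /= Nm; have [N0|N1] := posnP N.
  by rewrite N0 [RHS]big_geq// big1// => n _; rewrite aN ?N0 ?mulr0.
rewrite (big_cat_nat N1 Nm)/= [X in _ + X]big_nat [X in _ + X]big1 ?addr0//.
by move=> n /andP[Nn _]; rewrite aN ?mulr0.
Qed.

Section Bound.
Variables (p q M : R) (z : nat -> nat -> R[i]).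
Hypotheses (p0 : 0 < p) (q0 : 0 < q) (pq : p^-1 + q^-1 = 1) (M0 : 0 <= M).
Hypothesis zM : matnorm_le p q (fun n k => normc (z n k)) M.

Let zM_image a A N : 0 <= A -> (lpnorm p a <= A%:E)%E ->
  \sum_(1 <= k < N) (\sum_(1 <= n < N) normc (z n k) * normc (a n)) `^ p
  <= (M * A) `^ p.
Proof.
move=> A0 aA; apply: (matnorm_le_image_scaled p0 q0 pq _ M0 zM A0) => [n k|n|].
- exact: normc_ge0.
- exact: normc_ge0.
- by move: N; apply/lpnorm_leP.
Qed.

Lemma opmx_cvg a k : lp p a -> (0 < k)%N ->
  cvgn (fun N => \sum_(1 <= n < N) z n k * a n).
Proof.
move=> /lp_fineE[A A0 aA] k0; apply: (@abs_cvgc_series _ (M * A)) => N.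
under eq_bigr do rewrite normcM.
(* [matnorm_le] uses square sections, so the range is enlarged until it contains the row [k]. That
   row is then a single term of the p-sum of the image, which bounds it by [M * A]. *)
apply: (@le_trans _ _
  (\sum_(1 <= n < maxn N k.+1) normc (z n k) * normc (a n))).
  have [N0|N1] := posnP N.
    by rewrite N0 big_geq// sumr_ge0// => *; rewrite mulr_ge0 ?normc_ge0.
  rewrite (big_cat_nat N1 (leq_maxl N k.+1))/= lerDl sumr_ge0// => *.
  by rewrite mulr_ge0 ?normc_ge0.
have S0 j N' : 0 <= \sum_(1 <= n < N') normc (z n j) * normc (a n).
  by rewrite sumr_ge0// => *; rewrite mulr_ge0 ?normc_ge0.
rewrite -(@powR_leM _ p) ?mulr_ge0//.
have := @zM_image a A (maxn N k.+1) A0; rewrite aA => /(_ (lexx _)).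
apply: le_trans; rewrite [leRHS](@big_cat_nat _ _ _ k.+1) ?leq_maxr//=.
rewrite [X in X + _]big_nat_recr//= addrAC lerDr addr_ge0// sumr_ge0// => *;
  exact: powR_ge0.
Qed.

Lemma opmx_le a A : 0 <= A -> (lpnorm p a <= A%:E)%E ->
  (lpnorm p (opmx z a) <= (M * A)%:E)%E.
Proof.
move=> A0 aA; apply/lpnorm_leP; rewrite ?mulr_ge0// => N.
have la : lp p a by rewrite /lp/=; apply: le_lt_trans aA _; rewrite ltry.
pose s m k := \sum_(1 <= n < m) z n k * a n.
have s_le m : (N <= m)%N -> \sum_(1 <= k < N) normc (s m k) `^ p <= (M * A) `^ p.
  move=> Nm; apply: le_trans (zM_image m A0 aA).
  apply: (@le_trans _ _ (\sum_(1 <= k < N)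
      (\sum_(1 <= n < m) normc (z n k) * normc (a n)) `^ p)).
    apply: ler_sum => k _; rewrite powR_leM ?normc_ge0//.
      by apply: le_trans (normc_sum _ _ _) _; under eq_bigr do rewrite normcM.
    by rewrite sumr_ge0// => *; rewrite mulr_ge0 ?normc_ge0.
  have [N0|N1] := posnP N.
    by rewrite N0 big_geq// sumr_ge0// => *; exact: powR_ge0.
  by rewrite (big_cat_nat N1 Nm)/= lerDl sumr_ge0// => *; exact: powR_ge0.
(* The rows stay below [N] while the number [m] of columns tends to infinity. Testing against [h]
   first makes this a limit of finite linear combinations of moduli, so that no continuity of the
   power function is required. *)
apply: (holder_nat_converse p0 q0 pq) => [k||h h0 h1]; first exact: normc_ge0.
  exact: mulr_ge0.
have sh : (fun m => \sum_(1 <= k < N) normc (s m k) * h k) @ \oo -->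
    \sum_(1 <= k < N) normc (opmx z a k) * h k.
  apply: cvg_sum_nat => k /andP[k0 _]; apply: cvgMr_tmp.
  exact: (cvgc_normc (opmx_cvg la k0)).
rewrite -(cvg_lim (@Rhausdorff R) sh); apply: limr_le; first exact/cvgP/sh.
exists N => // m /= Nm; apply: (holder_nat p0 q0 pq) => // [k||].
- exact: normc_ge0.
- exact: mulr_ge0.
- exact: s_le.
Qed.

End Bound.
End ComplexMatrices.

(** * Compact operators *)

Section CompactOperators.
Context {R : realType}.
Implicit Types (z : nat -> nat -> R[i]) (a b : nat -> R[i]).

Lemma opmxD z c a b k :
  cvgn (fun N => \sum_(1 <= n < N) z n k * a n) ->
  cvgn (fun N => \sum_(1 <= n < N) z n k * b n) ->
  opmx z (fun n => c * a n + b n) k = c * opmx z a k + opmx z b k.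
Proof.
move=> ca cb; apply/cvg_lim; first exact: norm_hausdorff.
have -> : (fun N => \sum_(1 <= n < N) z n k * (c * a n + b n)) =
    (fun N => c * \sum_(1 <= n < N) z n k * a n) \+
    (fun N => \sum_(1 <= n < N) z n k * b n).
  apply/funext => N /=; rewrite mulr_sumr -big_split/=.
  by apply: eq_bigr => n _; rewrite mulrDr mulrCA.
have cal : (fun N => c * \sum_(1 <= n < N) z n k * a n) @ \oo --> c * opmx z a k.
  exact: (@cvgMl_tmp _ _ _ _ _ c _ ca).
exact: (cvgD cal cb).
Qed.

(* [th] and [sg] rotate the entries of [z] to nonnegative numbers, so that the
   vectors [th * f] with [f >= 0] see the norm of the matrix of moduli. *)
Lemma matnorm_le_of_opmx (p q : R) z (th sg : nat -> R[i]) (M : R) :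
  0 < p -> 0 < q -> p^-1 + q^-1 = 1 -> 0 <= M ->
  (forall n, normc (th n) = 1) -> (forall k, normc (sg k) = 1) ->
  (forall n k, z n k * th n = sg k * (normc (z n k))%:C%C) ->
  (forall a N, (forall n, (N <= n)%N -> a n = 0) ->
     (lpnorm p a <= 1)%E -> (lpnorm p (opmx z a) <= M%:E)%E) ->
  matnorm_le p q (fun n k => normc (z n k)) M.
Proof.
move=> p0 q0 pq M0 th1 sg1 zE zM.
apply: matnorm_le_of_image => // [n k|N f f0 f1]; first exact: normc_ge0.
pose a n := if (n < N)%N then th n * (f n)%:C%C else 0.
have aN n : (N <= n)%N -> a n = 0 by rewrite /a leqNgt => /negbTE ->.
have af n : (n < N)%N -> normc (a n) = f n.
  by move=> nN; rewrite /a nN normcM th1 mul1r normc_real.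
have a1 : (lpnorm p a <= 1)%E.
  rewrite (lpnorm_finsupp p0 aN) lee_fin.
  rewrite -[leRHS](_ : 1 `^ p^-1 = _); last by rewrite powR1.
  rewrite powR_leM ?invr_gt0// ?sumr_ge0// => [|*]; last exact: powR_ge0.
  by rewrite big_nat; under eq_bigr => n /andP[_ nN] do rewrite af//; rewrite -big_nat.
have /lpnorm_leP := zM a N aN a1 => /(_ p0 M0 N).
congr (_ <= _); apply: eq_bigr => k _; congr (_ `^ _).
rewrite (opmx_finsupp _ _ aN) big_nat.
under eq_bigr => n /andP[_ nN].
  rewrite /a nN mulrA zE -mulrA -rmorphM/=.
  over.
rewrite -big_nat -mulr_sumr -rmorph_sum/= normcM sg1 mul1r normc_real//.
by rewrite sumr_ge0// => *; rewrite mulr_ge0 ?normc_ge0.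
Qed.

Lemma homo_ltn_cvg (phi : nat -> nat) :
  {homo phi : m n / (m < n)%N} -> phi @ \oo --> \oo.
Proof.
move=> hphi; apply/cvgnyPge => n.
exists n => // k /= nk; apply: leq_trans nk _.
by elim: k => // k IH; apply: leq_ltn_trans IH _; exact: hphi.
Qed.

Section Lp.
Variable q : R.
Hypothesis q1 : 1 < q.
Let q0 : 0 < q. Proof. exact: lt_trans q1. Qed.
Implicit Types (S T : (nat -> R[i]) -> nat -> R[i]).

Lemma lp_lin c a b : lp q a -> lp q b -> lp q (fun n => c * a n + b n).
Proof.
rewrite /lp/= => la lb; apply: le_lt_trans (lpnormD _ _ q1) _.
rewrite lpnormZ// lte_add_pinfty//.
by move: la (lpnorm_ge0 q a); case: (lpnorm q a) => // r _ _; rewrite -EFinM ltry.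
Qed.

Lemma compact_on_lp0 : compact_on_lp q (fun _ _ => 0 : R[i]).
Proof.
have n0 : lpnorm q (fun=> 0 : R[i]) = 0%E.
  rewrite (@lpnorm_finsupp _ _ _ 0 q0)// big_geq// powR0// invr_neq0//.
  by rewrite gt_eqF.
have l0 : lp q (fun=> 0 : R[i]) by rewrite /lp/= n0.
split; first by split=> // *; rewrite mulr0 addr0.
move=> u _; exists id; split=> //; exists (fun=> 0) => //.
rewrite (_ : (fun _ => _) = cst 0%E); first exact: cvg_cst.
apply/funext => m; rewrite /= -[RHS]n0; congr lpnorm.
by apply/funext => k /=; rewrite subrr.
Qed.

Lemma compact_on_lpD S T : compact_on_lp q S -> compact_on_lp q T ->
  compact_on_lp q (fun a k => S a k + T a k).
Proof.
move=> [[Slp Slin] Sc] [[Tlp Tlin] Tc]; split.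
  split=> [a la|c a b la lb k k0].
    have := lp_lin 1 (Slp _ la) (Tlp _ la).
    by congr lp; apply/funext => k; rewrite mul1r.
  by rewrite Slin// Tlin// mulrDr addrACA.
move=> u [M uM]; have [f [fincr [b lb fb]]] := Sc u (ex_intro _ M uM).
have [g [gincr [b' lb' gb]]] := Tc (u \o f) (ex_intro _ M (fun m => uM (f m))).
exists (f \o g); split; first by move=> m n mn; apply: fincr; exact: gincr.
exists (fun k => 1 * b k + b' k); first exact: lp_lin.
apply: (@squeeze_cvge _ _ _ _ (cst 0%E) _
  (fun m => lpnorm q (S (u (f (g m))) \- b)%R + lpnorm q (T (u (f (g m))) \- b')%R)%E).
- apply: nearW => m; rewrite lpnorm_ge0/=.
  apply: le_trans (lpnormD _ _ q1); apply: le_lpnorm => // k _ /=.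
  by rewrite mul1r opprD addrACA.
- exact: cvg_cst.
- have Sb : lpnorm q (S (u (f (g m))) \- b) @[m --> \oo] --> 0%E.
    apply: (@cvg_comp _ _ _ g (fun m => lpnorm q (S (u (f m)) \- b))) fb.
    exact: homo_ltn_cvg.
  have S0 : ((0 : \bar R) +? 0)%E by [].
  have SD := cvgeD S0 Sb gb; rewrite (adde0 (0 : \bar R)) in SD.
  exact: SD.
Qed.

(** Bolzano-Weierstrass for the bounded scalars [l (u m)] provides the subsequence; the limit vector
    is a multiple of [e]. *)
Lemma compact_on_lp_rank1 (l : (nat -> R[i]) -> R[i]) (e : nat -> R[i]) (C : R) :
  lp q e ->
  (forall c a b, lp q a -> lp q b -> l (fun n => c * a n + b n) = c * l a + l b) ->
  (forall a (A : R), (lpnorm q a <= A%:E)%E -> normc (l a) <= C * A) ->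
  compact_on_lp q (fun a k => l a * e k).
Proof.
move=> le llin lC; split.
  split=> [a la|c a b la lb k k0]; last by rewrite llin// mulrDl mulrA.
  rewrite /lp/= lpnormZ//; move: le (lpnorm_ge0 q e); rewrite /lp/=.
  by case: (lpnorm q e) => // r _ _; rewrite -EFinM ltry.
move=> u [M uM].
have [phi phiincr /cvg_ex[x phix]] :=
  bolzano_weierstrass_complex (fun m => lC _ _ (uM m)).
exists phi; split => //; exists (fun k => x * e k).
  rewrite /lp/= lpnormZ//; move: le (lpnorm_ge0 q e); rewrite /lp/=.
  by case: (lpnorm q e) => // r _ _; rewrite -EFinM ltry.
have [E E0 EE] := lp_fineE le.
have -> : (fun m => lpnorm q ((fun k => l (u (phi m)) * e k) \- (fun k => x * e k)))
    = EFin \o (fun m => normc (x - l (u (phi m))) * E).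
  apply/funext => m.
  have -> : (fun k => l (u (phi m)) * e k) \- (fun k => x * e k) =
      (fun k => (l (u (phi m)) - x) * e k).
    by apply/funext => k; rewrite mulrBl.
  by rewrite lpnormZ// EE -normcN opprB.
apply: cvg_EFin; first exact: nearW.
rewrite -(mul0r E); apply: cvgMr_tmp.
move/cvgc_normcP : phix => phix; apply/cvgrPdist_lt => d d0.
by apply: filterS (phix d d0) => m; rewrite sub0r normrN ger0_norm ?normc_ge0.
Qed.

Lemma compact_on_lp_finrank (l : nat -> (nat -> R[i]) -> R[i])
    (e : nat -> nat -> R[i]) (C : nat -> R) D :
  (forall i, (0 < i)%N -> lp q (e i)) ->
  (forall i c a b, (0 < i)%N -> lp q a -> lp q b ->
    l i (fun n => c * a n + b n) = c * l i a + l i b) ->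
  (forall i a (A : R), (0 < i)%N -> (lpnorm q a <= A%:E)%E ->
    normc (l i a) <= C i * A) ->
  compact_on_lp q (fun a k => \sum_(1 <= i < D) l i a * e i k).
Proof.
move=> le llin lC; elim: D => [|[|D] IH].
- rewrite (_ : (fun _ _ => _) = (fun _ _ => 0)); first exact: compact_on_lp0.
  by apply/funext => a; apply/funext => k; rewrite big_geq.
- rewrite (_ : (fun _ _ => _) = (fun _ _ => 0)); first exact: compact_on_lp0.
  by apply/funext => a; apply/funext => k; rewrite big_geq.
rewrite (_ : (fun _ _ => _) = (fun a k =>
    \sum_(1 <= i < D.+1) l i a * e i k + l D.+1 a * e D.+1 k)).
  apply: compact_on_lpD; first exact: IH.
  apply: (@compact_on_lp_rank1 _ _ (C D.+1)).
  - exact: le.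
  - by move=> *; exact: llin.
  - by move=> *; exact: lC.
by apply/funext => a; apply/funext => k; rewrite big_nat_recr.
Qed.

End Lp.
End CompactOperators.

(** * Uniform smallness properties of compact operators *)

Section CompactTails.
Context {R : realType}.
Variable q : R.
Hypothesis q1 : 1 < q.
Let q0 : 0 < q. Proof. exact: lt_trans q1. Qed.
Implicit Types (a b : nat -> R[i]) (S T : (nat -> R[i]) -> nat -> R[i]).

Lemma opnorm_leP T (W : \bar R) :
  (opnorm q T <= W)%E <->
  (forall a, (lpnorm q a <= 1)%E -> (lpnorm q (T a) <= W)%E).
Proof.
split=> [TW a a1|TW].
  by apply: le_trans TW; apply: ereal_sup_ubound; exists a.
by apply: ge_ereal_sup => _ [a a1 <-]; exact: TW.
Qed.

(** The factor [1] puts the decomposition into the form [c * a + b] in which linearity is stated. *)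
Lemma seqtail_split N a :
  a = (fun k => 1 * seqtail N a k + (if (k < N)%N then a k else 0)).
Proof.
by apply/funext => k; rewrite /seqtail mul1r; case: ltnP; rewrite ?add0r ?addr0.
Qed.

Lemma le_seqtail N N' a : (N <= N')%N ->
  (lpnorm q (seqtail N' a) <= lpnorm q (seqtail N a))%E.
Proof.
move=> NN'; apply: le_lpnorm => // k _; rewrite /seqtail.
case: (leqP N' k) => [/(leq_trans NN') -> //|_].
by rewrite normc0; exact: normc_ge0.
Qed.

Lemma le_seqtail_id N a : (lpnorm q (seqtail N a) <= lpnorm q a)%E.
Proof.
apply: le_lpnorm => // k _; rewrite /seqtail.
by case: ifP => // _; rewrite normc0; exact: normc_ge0.
Qed.

Lemma lpnorm_cvg0 (v : nat -> nat -> R[i]) (e : R) : 0 < e ->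
  lpnorm q (v m) @[m --> \oo] --> 0%E ->
  \forall m \near \oo, (lpnorm q (v m) <= e%:E)%E.
Proof.
move=> e0 /fine_cvgP[vfin /cvgrPdist_lt/(_ _ e0)].
apply: filterS2 vfin => m mfin /=.
rewrite sub0r normrN ger0_norm; last by apply: fine_ge0; exact: lpnorm_ge0.
by move=> /ltW; rewrite -lee_fin fineK.
Qed.

(** Suppose each [N] had a counterexample [u N] in the unit ball. Along a subsequence the images
    tend to some [b] in l^q, so their tails are eventually within [e / 2] of the tails of [b], which
    are themselves small. *)
Lemma compact_seqtail_small T (e : R) : compact_on_lp q T -> 0 < e ->
  exists N, forall a, (lpnorm q a <= 1)%E ->
    (lpnorm q (seqtail N (T a)) <= e%:E)%E.
Proof.
move=> [_ Tc] e0; apply: contrapT => /forallNP H.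
have {}H N : exists a, (lpnorm q a <= 1)%E /\
    ~ (lpnorm q (seqtail N (T a)) <= e%:E)%E.
  have /existsNP[a /not_implyP[a1 aT]] := H N; by exists a.
have [u uP] := choice H.
have [|phi [phiincr [b lb cb]]] := Tc u; first by exists 1 => m; exact: (uP m).1.
have e2 : 0 < e / 2 by rewrite divr_gt0.
have [N bN] := lpnorm_seqtail_small q0 e2 lb.
have [m [Nm cm]] : exists m, (N <= phi m)%N /\
    (lpnorm q (T (u (phi m)) \- b)%R <= (e / 2)%:E)%E.
  have H1 : \forall m \near \oo, (N <= phi m)%N.
    by have /cvgnyPge := homo_ltn_cvg phiincr; apply.
  have [m _ Hm] := filterI H1 (lpnorm_cvg0 e2 cb); exists m.
  exact: Hm m (leqnn m).
(* The vector [u (phi m)] violates the bound for the cut at [phi m], not at [N]; as [N <= phi m],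
   the tail of [b] from [phi m] on is still at most [e / 2]. *)
apply: (uP (phi m)).2; rewrite [e]splitr EFinD.
have -> : seqtail (phi m) (T (u (phi m))) = fun k =>
    seqtail (phi m) (T (u (phi m)) \- b) k + seqtail (phi m) b k.
  apply/funext => k; rewrite /seqtail; case: ifP => _ /=; last by rewrite addr0.
  by rewrite subrK.
apply: le_trans (lpnormD _ _ q1) _; apply: leeD.
  exact: le_trans (le_seqtail_id _ _) cm.
exact: le_trans (le_seqtail _ Nm) bN.
Qed.

(** Boundedness is not part of [compact_on_lp]. If the images of unit vectors had norms exceeding
    every [n], a convergent subsequence of them would still be bounded by [1 + B], with [B] the norm
    of its limit. *)
Lemma compact_bounded T : compact_on_lp q T ->
  exists2 B : R, 0 <= B & forall a, (lpnorm q a <= 1)%E -> (lpnorm q (T a) <= B%:E)%E.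
Proof.
move=> [_ Tc]; apply: contrapT => H.
have {}H (n : nat) : exists a, (lpnorm q a <= 1)%E /\ ~ (lpnorm q (T a) <= n%:R%:E)%E.
  apply: contrapT => /forallNP Hn; apply: H; exists n%:R => // a a1.
  by have /not_andP[//|/contrapT] := Hn a.
have [u uP] := choice H.
have [|phi [phiincr [b lb cb]]] := Tc u; first by exists 1 => m; exact: (uP m).1.
have [B B0 EB] := lp_fineE lb.
have [n0 _ Hn0] := lpnorm_cvg0 ltr01 cb.
have [n1 n1B] : exists n : nat, 1 + B <= n%:R.
  by exists (Num.bound (1 + B)); apply/ltW/archi_boundP; rewrite addr_ge0.
pose m := maxn n0 n1; have mb := Hn0 m (leq_maxl _ _).
apply: (uP (phi m)).2.
have -> : T (u (phi m)) = fun k => (T (u (phi m)) \- b) k + b k.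
  by apply/funext => k /=; rewrite subrK.
apply: le_trans (lpnormD _ _ q1) _; apply: (@le_trans _ _ (1 + B)%:E).
  by rewrite EFinD leeD// EB.
rewrite lee_fin; apply: le_trans n1B _; rewrite ler_nat.
apply: leq_trans (leq_maxr n0 n1) _; rewrite -/m.
by elim: (m) => // k IH; apply: leq_ltn_trans IH _; exact: phiincr.
Qed.

(** At each index at most one block is nonzero, so the q-th powers of the norms add. *)
Lemma lpnorm_disjoint_sum (w : nat -> nat -> R[i]) (s : nat -> nat) N :
  (forall i, (lpnorm q (w i) <= 1)%E) -> {homo s : i j / (i <= j)%N} ->
  (forall i k, ~~ (s i <= k < s i.+1)%N -> w i k = 0) ->
  (lpnorm q (fun k => (\sum_(i < N) w i k)%R) <= (N%:R `^ q^-1)%:E)%E.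
Proof.
move=> w1 s_homo ws; apply/lpnorm_leP => // n; rewrite powRVK ?gt_eqF//.
elim: N => [|N IH].
  by rewrite big1// => k _; rewrite big_ord0 normc0 powR0 ?gt_eqF.
rewrite -natr1; have /lpnorm_leP wN := w1 N.
have {}wN := wN q0 ler01 n; rewrite powR1 in wN.
apply: le_trans (lerD IH wN); rewrite -big_split/=; apply: ler_sum => k _.
rewrite big_ord_recr/=; case: (boolP (s N <= k < s N.+1)%N) => [/andP[sk _]|/ws ->].
  rewrite big1 ?add0r ?lerDr ?powR_ge0// => i _; apply: ws.
  by rewrite negb_and -leqNgt orbC (leq_trans _ sk)// s_homo.
by rewrite addr0 lerDl powR_ge0.
Qed.

Lemma linear_finsum (l : (nat -> R[i]) -> R[i]) (w : nat -> nat -> R[i]) N :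
  (forall c a b, lp q a -> lp q b -> l (fun n => c * a n + b n) = c * l a + l b) ->
  (forall i, lp q (w i)) ->
  lp q (fun k => \sum_(i < N) w i k) /\
  l (fun k => \sum_(i < N) w i k) = \sum_(i < N) l (w i).
Proof.
move=> llin lw; elim: N => [|N [IHlp IH]].
  have l0 : lp q (fun=> 0 : R[i]) by exact: (@lp_finsupp _ _ _ 0).
  rewrite (_ : (fun _ => _) = (fun=> 0)); last by apply/funext => k; rewrite big_ord0.
  split=> //; rewrite big_ord0; have := llin 1 _ _ l0 l0.
  rewrite (_ : (fun _ => _) = (fun=> 0)); last by apply/funext => k; rewrite mulr0 addr0.
  by rewrite mul1r => /eqP; rewrite -subr_eq0 opprD addrA subrr sub0r oppr_eq0 => /eqP.
rewrite (_ : (fun _ => _) = (fun k => 1 * w N k + \sum_(i < N) w i k)); last first.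
  by apply/funext => k; rewrite big_ord_recr/= mul1r addrC.
by split; [exact: lp_lin|rewrite llin// IH big_ord_recr/= mul1r addrC].
Qed.

(* A bounded functional sends the sum of N disjoint unit blocks to O(N^(1/q)),
   while the sum of N values close to some c <> 0 grows like N. *)
Lemma disjoint_functional_lim (l : (nat -> R[i]) -> R[i]) (B : R)
    (w : nat -> nat -> R[i]) (s : nat -> nat) (c : R[i]) :
  (forall c a b, lp q a -> lp q b -> l (fun n => c * a n + b n) = c * l a + l b) ->
  (forall a, (lpnorm q a <= 1)%E -> normc (l a) <= B) ->
  (forall i, (lpnorm q (w i) <= 1)%E) -> {homo s : i j / (i <= j)%N} ->
  (forall i k, ~~ (s i <= k < s i.+1)%N -> w i k = 0) ->
  l (w i) @[i --> \oo] --> c -> c = 0.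
Proof.
move=> llin lB w1 s_homo ws /cvgc_normcP lwc.
have lw i : lp q (w i) by rewrite /lp/=; apply: le_lt_trans (w1 i) _; rewrite ltry.
apply: contrapT => /eqP c0.
have nc0 : 0 < normc c.
  rewrite lt_neqAle normc_ge0 andbT eq_sym.
  by apply: contra c0 => /eqP/eq0_normc ->.
have [n0 _ Hn0] := lwc (normc c / 2) ltac:(by rewrite divr_gt0).
(* Discarding the first [n0] blocks leaves only values within [|c| / 2] of [c], so that [N] of them
   sum to at least [N |c| / 2] in modulus. *)
pose v i := w (n0 + i)%N.
have vB N : (0 < N)%N -> N%:R * (normc c / 2) <= B * N%:R `^ q^-1.
  move=> N0; have [vlp lv] := linear_finsum N llin (fun i => lw (n0 + i)%N).
  have Nq : 0 < (N%:R : R) `^ q^-1 by rewrite powR_gt0// ltr0n.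
  (* The summand [0] lets linearity, stated for [c * a + b], serve as homogeneity. *)
  pose x := fun k => ((N%:R `^ q^-1)^-1)%:C%C * (\sum_(i < N) v i k) + 0.
  have x1 : (lpnorm q x <= 1)%E.
    rewrite /x (_ : (fun _ => _) = (fun k =>
        ((N%:R `^ q^-1)^-1)%:C%C * (\sum_(i < N) v i k))); last first.
      by apply/funext => k; rewrite addr0.
    rewrite lpnormZ// normc_real; last by rewrite invr_ge0 ltW.
    apply: (@le_trans _ _ (((N%:R `^ q^-1)^-1)%:E * (N%:R `^ q^-1)%:E)%E).
      apply: lee_wpmul2l; first by rewrite lee_fin invr_ge0 ltW.
      apply: (@lpnorm_disjoint_sum _ (fun i => s (n0 + i)%N)).
      - by move=> i; exact: w1.
      - by move=> i j ij; apply: s_homo; rewrite leq_add2l.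
      - by move=> i k; rewrite addnS; exact: ws.
    by rewrite -EFinM mulVf// gt_eqF.
  have l0 : lp q (fun=> 0 : R[i]) by exact: (@lp_finsupp _ _ _ 0).
  have l_0 : l (fun=> 0) = 0.
    have [_] := linear_finsum 0 llin lw; rewrite big_ord0 => l0E; rewrite -[RHS]l0E.
    by congr l; apply/funext => k; rewrite big_ord0.
  have := lB x x1; rewrite /x llin// l_0 addr0 normcM normc_real; last first.
    by rewrite invr_ge0 ltW.
  rewrite mulrC ler_pdivrMr// => /(le_trans _); apply.
  rewrite lv; set S := \sum_(i < N) _.
  have : normc (N%:R * c - S) <= N%:R * (normc c / 2).
    rewrite (_ : N%:R * c - S = \sum_(i < N) (c - l (v i))).
      apply: le_trans (normc_sum _ _ _) _.
      apply: (@le_trans _ _ (\sum_(i < N) (normc c / 2))).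
        by apply: ler_sum => i _; apply/ltW/Hn0; rewrite /= leq_addr.
      by rewrite sumr_const card_ord mulr_natl.
    by rewrite big_split/= sumr_const card_ord mulr_natl sumrN.
  have : normc (N%:R * c) <= normc (N%:R * c - S) + normc S.
    by rewrite -[in leLHS](subrK S (N%:R * c)) le_normcD.
  have -> : normc (N%:R * c) = N%:R * normc c.
    by rewrite normcM -(rmorph_nat (real_complex R)) normc_real.
  lra.
(* Dividing [N |c| / 2 <= B N^(1/q)] by [N^(1/q)] leaves [N^r] bounded; [q > 1] makes [r] positive,
   and [N] just above [X^(1/r)] gives the contradiction. *)
pose r := 1 - q^-1.
have r0 : 0 < r by rewrite subr_gt0 invf_lt1.
pose X := B / (normc c / 2).
have vX N : (0 < N)%N -> (N%:R : R) `^ r <= X.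
  move=> N0; have := vB N N0; rewrite -ler_pdivlMr ?divr_gt0//.
  rewrite mulrAC -/X powRB; last by rewrite pnatr_eq0 -lt0n N0 implybT.
  by rewrite powRr1// ler_pdivrMr ?powR_gt0 ?ltr0n.
have X0 : 0 <= X by apply: le_trans (vX 1%N isT); exact: powR_ge0.
pose N := (Num.bound (X `^ r^-1)).+1.
have := vX N isT; apply/negP; rewrite -ltNge.
rewrite -[ltLHS](@powRVK _ r) ?gt_eqF//; apply: gt0_ltr_powR => //.
- by rewrite nnegrE powR_ge0.
- rewrite nnegrE//.
apply: lt_le_trans (archi_boundP (powR_ge0 _ _)) _.
by rewrite ler_nat.
Qed.

(* Otherwise there are disjoint unit blocks [v j] whose images along a
   subsequence tend to some [b] with norm bounded below, but every coordinate of
   [b] vanishes by [disjoint_functional_lim]. *)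
Lemma compact_finsupp_small T (e : R) : compact_on_lp q T -> 0 < e ->
  exists D, forall a N, (forall k, (N <= k)%N -> a k = 0) ->
    (forall k, (k < D)%N -> a k = 0) -> (lpnorm q a <= 1)%E ->
    (lpnorm q (T a) <= e%:E)%E.
Proof.
move=> Tcomp e0; have [B B0 TB] := compact_bounded Tcomp.
have [[Tlp Tlin] Tc] := Tcomp.
apply: contrapT => /forallNP H.
have {}H D : exists aN : (nat -> R[i]) * nat, [/\ (D <= aN.2)%N,
    forall k, ~~ (D <= k < aN.2)%N -> aN.1 k = 0,
    (lpnorm q aN.1 <= 1)%E & ~ (lpnorm q (T aN.1) <= e%:E)%E].
  have /existsNP[a /existsNP[N /not_implyP[aN /not_implyP[aD]]]] := H D.
  move=> /not_implyP[a1 Ta]; exists (a, maxn D N); split=> //=.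
    exact: leq_maxl.
  move=> k; rewrite negb_and -ltnNge -leqNgt => /orP[/aD//|].
  by rewrite geq_max => /andP[_ /aN].
have [F FP] := choice H.
(* [F D] is a counterexample supported in [[D, (F D).2)]; each new block starts where the previous
   one ends. *)
pose s := fun j => iter j (fun D => (F D).2) 0%N.
have s_homo : {homo s : i j / (i <= j)%N}.
  by apply: homo_leq => [//|i j k|j]; [exact: leq_trans|case: (FP (s j))].
pose v j := (F (s j)).1.
have v1 j : (lpnorm q (v j) <= 1)%E by case: (FP (s j)).
have [|phi [phiincr [b lb cb]]] := Tc v; first by exists 1.
have b0 k : (0 < k)%N -> b k = 0.
  move=> k0.
  apply: (@disjoint_functional_lim (fun a => T a k) B (v \o phi) (s \o phi)).
  - by move=> *; exact: Tlin.
  - move=> a /TB Ta; rewrite -lee_fin; apply: le_trans Ta.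
    exact: normc_le_lpnorm.
  - by move=> i; exact: v1.
  - move=> i j ij; apply: s_homo; move: ij; rewrite leq_eqVlt => /predU1P[->//|].
    by move/phiincr/ltnW.
  (* The subsequence leaves gaps between the blocks, but [s (phi i).+1 <= s (phi i.+1)], so each
     block lies in its enlarged interval and these remain disjoint. *)
  - move=> i k' /= sk; have [_ + _ _] := FP (s (phi i)); apply.
    apply: contra sk => /andP[-> /=] /leq_trans; apply.
    by apply: (s_homo (phi i).+1); exact: phiincr.
  - apply/cvgc_normcP => d d0; have d2 : 0 < d / 2 by rewrite divr_gt0.
    apply: filterS (lpnorm_cvg0 d2 cb) => m mb.
    rewrite -normcN opprB; apply: (@le_lt_trans _ _ (d / 2)); last by lra.
    rewrite -lee_fin; apply: le_trans mb.
    exact: (normc_le_lpnorm (T (v (phi m)) \- b)).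
have [m _ Hm] := lpnorm_cvg0 e0 cb.
have [_ _ _] := FP (s (phi m)); apply; apply: le_trans (Hm m (leqnn m)).
by apply: le_lpnorm => // k k0; rewrite /= b0// subr0.
Qed.
End CompactTails.

(** * Essential norms *)

Section EssentialNorm.
Context {R : realType}.
Implicit Types (a b g : nat -> R[i]).

Lemma matnorm_le_sub (p q : R) (kap kap' : nat -> nat -> R) (M : R) :
  (forall n k, (0 < n)%N -> (0 < k)%N -> kap n k <= kap' n k) ->
  matnorm_le p q kap' M -> matnorm_le p q kap M.
Proof.
move=> kk kM N f h f0 h0 f1 h1; apply: le_trans (kM N f h f0 h0 f1 h1).
rewrite big_nat [leRHS]big_nat; apply: ler_sum => k /andP[k1 _].
apply: ler_wpM2r => //; rewrite big_nat [leRHS]big_nat.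
by apply: ler_sum => n /andP[n1 _]; apply: ler_wpM2r => //; exact: kk.
Qed.

(** The value 1 at 0 keeps the modulus equal to 1 everywhere, as [matnorm_le_of_opmx] requires. *)
Definition phase (x : R[i]) : R[i] := if x == 0 then 1 else x / (normc x)%:C%C.

Lemma phaseE x : x = phase x * (normc x)%:C%C.
Proof.
rewrite /phase; case: eqP => [->|/eqP x0]; first by rewrite normc0 rmorph0 mulr0.
rewrite divfK// -normcE_norm normr_eq0//.
Qed.

Lemma scale_phaseE (r : R) x : r%:C%C * x = phase x * (r * normc x)%:C%C.
Proof. by rewrite rmorphM/= mulrCA -phaseE. Qed.

Lemma normc_phase x : normc (phase x) = 1.
Proof.
rewrite /phase; case: eqP => [_|/eqP x0]; first exact: normc1.
have nx0 : normc x != 0 by apply: contra x0 => /eqP/eq0_normc ->.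
by rewrite normcM normcV normc_real ?normc_ge0// divff.
Qed.

Definition hker (gamma : R) (n k : nat) : R :=
  (k%:R / n%:R) `^ gamma / (n + k)%:R.

Lemma hker_ge0 gamma n k : 0 <= hker gamma n k.
Proof. by rewrite divr_ge0// powR_ge0. Qed.

(* [hmat D] is the matrix of the tail (k >= D) of [Hop]; that of [Hdual] is the
   transpose. *)
Definition hmat D g gamma (n k : nat) : R[i] :=
  if (D <= k)%N then (hker gamma n k)%:C%C * g k else 0.

Lemma hop_term (x : R) (y w : R[i]) n :
  (x%:C)%C * (y * w / n%:R) = ((x / n%:R)%:C)%C * y * w.
Proof.
rewrite rmorphM/= fmorphV rmorph_nat -!mulrA; congr (_ * _).
by rewrite mulrA mulrC.
Qed.

Lemma opmx_eq (z z' : nat -> nat -> R[i]) a b k :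
  (forall n, z n k * a n = z' n k * b n) -> opmx z a k = opmx z' b k.
Proof.
by move=> zz; congr (limn _); apply/funext => N; apply: eq_bigr => n _.
Qed.

Lemma HopE g gamma a k : Hop g gamma a k = opmx (hmat 0 g gamma) a k.
Proof.
congr (limn _); apply/funext => N; apply: eq_bigr => n _.
by rewrite hop_term.
Qed.

Lemma HdualE g gamma b n : Hdual g gamma b n = opmx (fun k n => hmat 0 g gamma n k) b n.
Proof.
congr (limn _); apply/funext => N; apply: eq_bigr => k _.
by rewrite hop_term.
Qed.

Lemma seqtail_Hop D g gamma a :
  seqtail D (Hop g gamma a) = opmx (hmat D g gamma) a.
Proof.
apply/funext => k; rewrite /seqtail; case: ifPn => Dk.
  by rewrite HopE; apply: opmx_eq => n; rewrite /hmat Dk.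
apply/esym; rewrite (_ : opmx _ _ _ = opmx (fun _ _ => 0) (fun=> 0) k).
  by rewrite (@opmx_finsupp _ _ _ 0)// big_geq.
by apply: opmx_eq => n; rewrite /hmat (negbTE Dk) !mul0r.
Qed.

Lemma Hdual_seqtail D g gamma b :
  Hdual g gamma (seqtail D b) = opmx (fun k n => hmat D g gamma n k) b.
Proof.
apply/funext => n; rewrite HdualE; apply: opmx_eq => k.
by rewrite /seqtail /hmat; case: ifPn => _; rewrite ?mulr0 ?mul0r.
Qed.

Lemma normc_hmat D g gamma n k :
  normc (hmat D g gamma n k) = if (D <= k)%N then hker gamma n k * normc (g k) else 0.
Proof.
by rewrite /hmat; case: ifP => _; rewrite ?normc0// normcM normc_real// hker_ge0.
Qed.

Lemma normc_hmat_abs D g gamma n k :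
  normc (hmat D (absseq g) gamma n k) = normc (hmat D g gamma n k).
Proof.
rewrite !normc_hmat /absseq [normc `|_|](_ : _ = normc (g k))//.
by rewrite normcE_norm normc_real// normc_ge0.
Qed.

(** * Norms of the tails and the two essential norms *)

Section Fixed.
Variables (p p' gamma : R) (d : nat -> nat) (g : nat -> R[i]).
Hypotheses (p_gt1 : 1 < p) (conj_pp' : p^-1 + p'^-1 = 1).
Hypotheses (d_incr : forall n, (d n < d n.+1)%N) (d0 : d 0%N = 1%N).

Let p0 : 0 < p. Proof. exact: lt_trans p_gt1. Qed.

Lemma conj_exponent : p' = (1 - p^-1)^-1.
Proof. by rewrite -conj_pp' addrC addKr invrK. Qed.

Lemma conj_gt1 : 1 < p'.
Proof.
by rewrite conj_exponent invf_gt1 ?subr_gt0 ?invf_lt1// ltrBlDr ltrDl invr_gt0.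
Qed.

Let p'0 : 0 < p'. Proof. exact: lt_trans conj_gt1. Qed.

Let conj_p'p : p'^-1 + p^-1 = 1. Proof. by rewrite addrC. Qed.

Lemma block_homo : {homo d : i j / (i <= j)%N}.
Proof. by apply: homo_leq => // [i j k|i]; [exact: leq_trans|exact: ltnW]. Qed.

Lemma block_ge n : (n < d n)%N.
Proof. by elim: n => [|n IH]; [rewrite d0|exact: leq_ltn_trans IH (d_incr n)]. Qed.

Let d_gt0 n : (0 < d n)%N. Proof. exact: leq_ltn_trans (block_ge n). Qed.

(** [K = 0] and [K = 1] give the same cut at [d 0 = 1], so admitting [K = 0] changes neither the
    limit nor the infimum. *)
Definition tailsup K : \bar R :=
  ereal_sup [set Ctail p gamma d K (absseq g) a | a in [set a | lpnorm p a = 1%E]].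

Definition tailnorm_le D := matnorm_le p p' (fun n k => normc (hmat D g gamma n k)).

Lemma CtailE K h a :
  Ctail p gamma d K h a = lpnorm p (opmx (hmat (d K.-1) h gamma) a).
Proof. by rewrite -seqtail_Hop lpnorm_seqtail. Qed.

Lemma tailsup_ge0 K : (0 <= tailsup K)%E.
Proof.
(* A unit vector has to be exhibited, since the supremum of the empty set is [-oo]. *)
pose e1 : nat -> R[i] := fun k => (k == 1%N)%:R.
have e10 k : (2 <= k)%N -> e1 k = 0 by rewrite /e1; case: k => [|[|]].
apply: (@le_trans _ _ (Ctail p gamma d K (absseq g) e1)).
  by rewrite CtailE lpnorm_ge0.
apply: ereal_sup_ubound; exists e1 => //=.
by rewrite (lpnorm_finsupp p0 e10) big_nat1 /e1 normc1 !powR1.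
Qed.

Lemma tailsup_noninc : nonincreasing_seq tailsup.
Proof.
move=> K L KL; apply: ge_ereal_sup => _ [a a1 <-].
apply: (@le_trans _ _ (Ctail p gamma d K (absseq g) a)).
  rewrite !CtailE -!seqtail_Hop; apply: le_seqtail => //.
  by apply: block_homo; rewrite -!subn1 leq_sub2r.
by apply: ereal_sup_ubound; exists a.
Qed.

Lemma tailnorm_le_tailsup K (M : R) : 0 <= M -> tailnorm_le (d K.-1) M ->
  (tailsup K <= M%:E)%E.
Proof.
move=> M0 gM; apply: ge_ereal_sup => _ [a /= a1 <-]; rewrite CtailE -[M]mulr1.
apply: (opmx_le p0 p'0 conj_pp' M0) => //; last by rewrite a1.
by apply: matnorm_le_sub gM => n k _ _; rewrite normc_hmat_abs.
Qed.

Lemma tailsup_tailnorm_le K (M : R) : 0 <= M -> (tailsup K <= M%:E)%E ->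
  tailnorm_le (d K.-1) M.
Proof.
move=> M0 gM; pose z := hmat (d K.-1) (absseq g) gamma.
suff : matnorm_le p p' (fun n k => normc (z n k)) M.
  by apply: matnorm_le_sub => n k _ _; rewrite normc_hmat_abs.
apply: (@matnorm_le_of_opmx _ _ _ _ (fun=> 1) (fun=> 1)) => //.
- by move=> _; exact: normc1.
- by move=> _; exact: normc1.
- move=> n k; rewrite mulr1 mul1r normc_hmat_abs normc_hmat /z /hmat.
  by case: ifP => _; rewrite ?rmorph0// /absseq normcE_norm -rmorphM.
move=> a N aN a1; have [A A0 EA] := lp_fineE (lp_finsupp p0 aN).
(* [tailsup] sees only vectors of norm exactly 1, so [a] must be normalised; the case of norm 0 is
   settled first. *)
move: A0; rewrite le_eqVlt => /predU1P[A0|A0].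
  have aE k : (0 < k)%N -> a k = 0.
    move=> k0; have := normc_le_lpnorm a p0 k0; rewrite EA -A0 lee_fin => ak.
    by apply: eq0_normc; apply/eqP; rewrite eq_le ak normc_ge0.
  rewrite (_ : lpnorm _ _ = 0%E) ?lee_fin//.
  rewrite (@lpnorm_finsupp _ _ _ 0)// => [|k _].
    by rewrite big_geq// powR0// invr_neq0// gt_eqF.
  by rewrite (opmx_finsupp _ _ aN) big_nat big1// => n /andP[n1 _]; rewrite aE ?mulr0.
pose a' n := (A^-1)%:C%C * a n.
have a'N n : (N <= n)%N -> a' n = 0 by move=> /aN; rewrite /a' => ->; rewrite mulr0.
have a'1 : lpnorm p a' = 1%E.
  by rewrite lpnormZ// normc_real ?invr_ge0 ?(ltW A0)// EA -EFinM mulVf// gt_eqF.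
have : (lpnorm p (opmx z a') <= M%:E)%E.
  by apply: le_trans gM; rewrite -CtailE; apply: ereal_sup_ubound; exists a'.
have -> : opmx z a' = fun k => (A^-1)%:C%C * opmx z a k.
  apply/funext => k; rewrite (opmx_finsupp _ _ aN) (opmx_finsupp _ _ a'N).
  by rewrite mulr_sumr; apply: eq_bigr => n _; rewrite mulrCA.
rewrite lpnormZ// normc_real ?invr_ge0 ?(ltW A0)// lee_pdivrMl// => /le_trans; apply.
by rewrite -EFinM lee_fin ler_piMl// -lee_fin -EA.
Qed.

Hypothesis Hbnd : bounded_on_lp p (Hop g gamma).

(** One bound serves every [D] because the cut only replaces entries of a nonnegative matrix by 0.
    The absolute value is taken since the constant in [bounded_on_lp] may be negative. *)
Lemma bounded_tailnorm_le : exists2 M : R, 0 <= M & forall D, tailnorm_le D M.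
Proof.
have [_ [M HM]] := Hbnd; exists `|M| => // D.
apply: (@matnorm_le_sub _ _ _ (fun n k => normc (hmat 0 g gamma n k))).
  move=> n k _ _; rewrite !normc_hmat/=; case: ifP => // _.
  by rewrite mulr_ge0 ?hker_ge0 ?normc_ge0.
apply: (@matnorm_le_of_opmx _ _ _ _ (fun=> 1) (phase \o g)) => //.
- by move=> _; exact: normc1.
- by move=> k; exact: normc_phase.
- move=> n k; by rewrite mulr1 normc_hmat /hmat/= scale_phaseE.
move=> a N aN a1; have := HM a (lp_finsupp p0 aN).
rewrite (_ : Hop g gamma a = opmx (hmat 0 g gamma) a); last first.
  by apply/funext => k; rewrite HopE.
move=> /le_trans; apply.
have [A A0 EA] := lp_fineE (lp_finsupp p0 aN); rewrite EA -EFinM lee_fin.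
apply: (@le_trans _ _ (`|M| * A)); first by rewrite ler_wpM2r// ler_norm.
by rewrite ler_piMr// -lee_fin -EA.
Qed.

Lemma tailsup_fin K : exists2 M : R, 0 <= M & tailsup K = M%:E.
Proof.
have [M M0 HM] := bounded_tailnorm_le.
have := tailnorm_le_tailsup M0 (HM (d K.-1)); have := tailsup_ge0 K.
by case: (tailsup K) => [r| |] // r0 _; exists r.
Qed.

Lemma essnorm_Hop_le K : (essnorm p (Hop g gamma) <= tailsup K)%E.
Proof.
have [M0 M00 HM0] := bounded_tailnorm_le; have [M Mge0 EM] := tailsup_fin K.
have HM : tailnorm_le (d K.-1) M by apply: tailsup_tailnorm_le; rewrite ?EM.
rewrite EM; set D := d K.-1 in HM *.
pose T a k := \sum_(1 <= i < D) Hop g gamma a i * (k == i)%:R.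
apply: (@le_trans _ _ (opnorm p (fun a => Hop g gamma a \- T a))).
  apply: ereal_inf_lbound; exists T => //.
  apply: (@compact_on_lp_finrank _ _ p_gt1 (fun i a => Hop g gamma a i) _ (fun=> M0)).
  - move=> i _; apply: (@lp_finsupp _ _ _ i.+1) => // k ik.
    by rewrite gtn_eqF.
  - by move=> i c a b i0 la lb; apply: Hbnd.1.2.
  - move=> i a A i0 aA; rewrite -lee_fin; apply: le_trans (normc_le_lpnorm _ p0 i0) _.
    rewrite (_ : Hop g gamma a = opmx (hmat 0 g gamma) a); last first.
      by apply/funext => k; rewrite HopE.
    apply: (opmx_le p0 p'0 conj_pp' M00 (HM0 0%N)) => //.
    by rewrite -lee_fin (le_trans _ aA)// lpnorm_ge0.
apply/opnorm_leP => a a1; rewrite (@eq_lpnorm _ _ _ (opmx (hmat D g gamma) a))//.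
  by rewrite -[M]mulr1; apply: (opmx_le p0 p'0 conj_pp' Mge0 HM).
move=> k k0; rewrite -seqtail_Hop /seqtail /T /=.
have [Dk|kD] := leqP D k.
  rewrite big_nat big1 ?subr0// => i /andP[_ iD].
  by rewrite gtn_eqF ?mulr0// (leq_trans iD).
rewrite (bigD1_seq k) ?mem_index_iota ?k0 ?iota_uniq//= eqxx mulr1 big1 ?addr0 ?subrr//.
by move=> i ik; rewrite eq_sym (negbTE ik) mulr0.
Qed.

Lemma essnorm_Hdual_le K : (essnorm p' (Hdual g gamma) <= tailsup K)%E.
Proof.
have [M0 M00 HM0] := bounded_tailnorm_le; have [M Mge0 EM] := tailsup_fin K.
have HM : tailnorm_le (d K.-1) M by apply: tailsup_tailnorm_le; rewrite ?EM.
rewrite EM; set D := d K.-1 in HM *.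
pose T b n := \sum_(1 <= i < D) b i * hmat 0 g gamma n i.
apply: (@le_trans _ _ (opnorm p' (fun a => Hdual g gamma a \- T a))).
  apply: ereal_inf_lbound; exists T => //.
  apply: (@compact_on_lp_finrank _ _ conj_gt1 (fun i b => b i) _ (fun=> 1)) => //.
  (* The [i]-th column of the dual matrix is the image of the [i]-th unit vector, hence lies in
     l^p'. *)
  - move=> i i0; pose e : nat -> R[i] := fun k => (k == i)%:R.
    have eN k : (i < k)%N -> e k = 0 by move=> ik; rewrite /e gtn_eqF.
    have [A A0 EA] := lp_fineE (lp_finsupp p'0 eN).
    rewrite /lp/=; apply: (@le_lt_trans _ _ (M0 * A)%:E); last exact: ltry.
    have := @opmx_le _ p' p M0 (fun k n => hmat 0 g gamma n k) p'0 p0 conj_p'p M00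
      (matnorm_le_tr (HM0 0%N)) e A A0.
    rewrite EA => /(_ (lexx _)); apply: le_trans; apply: le_lpnorm => // n _.
    rewrite (opmx_finsupp _ _ eN) big_nat_recr//= {2}/e eqxx mulr1 big_nat big1 ?add0r//.
    by move=> k /andP[_ ki]; rewrite /e ltn_eqF ?mulr0.
  - move=> i a A i0 aA; rewrite mul1r -lee_fin.
    exact: le_trans (normc_le_lpnorm _ p'0 i0) _.
apply/opnorm_leP => b b1.
have lb : lp p' b by rewrite /lp/=; apply: le_lt_trans b1 _; rewrite ltry.
have lbt : lp p' (seqtail D b).
  by rewrite /lp/=; apply: le_lt_trans lb; exact: le_seqtail_id conj_gt1 _ _.
(* The dual series is split into head and tail of [b]; additivity of its limit needs both parts to
   converge, which the transposed form bound ensures. *)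
pose hd k := if (k < D)%N then b k else 0.
have hdD k : (D <= k)%N -> hd k = 0 by rewrite /hd leqNgt => /negbTE ->.
rewrite (@eq_lpnorm _ _ _ (opmx (fun k n => hmat D g gamma n k) b))//.
  rewrite -[M]mulr1; apply: (opmx_le p'0 p0 conj_p'p Mge0) => //.
  exact: matnorm_le_tr HM.
move=> n n0; rewrite -Hdual_seqtail /= !HdualE.
have -> : opmx (fun k n => hmat 0 g gamma n k) b n =
    opmx (fun k n => hmat 0 g gamma n k) (fun k => 1 * seqtail D b k + hd k) n.
  by congr opmx; exact: seqtail_split.
rewrite opmxD; last 2 first.
- exact: (opmx_cvg p'0 p0 conj_p'p M00 (matnorm_le_tr (HM0 0%N))).
- exact: (opmx_cvg p'0 p0 conj_p'p M00 (matnorm_le_tr (HM0 0%N))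
    (lp_finsupp p'0 hdD)).
rewrite mul1r (opmx_finsupp _ _ hdD) /T -[RHS]addr0 -addrA; congr (_ + _).
apply/eqP; rewrite subr_eq0; apply/eqP; apply: eq_big_nat => i /andP[_ iD].
by rewrite /hd iD mulrC.
Qed.

Lemma tailsup_le_opnorm_Hop T : compact_on_lp p T ->
  (ereal_inf (range tailsup) <= opnorm p (fun a => Hop g gamma a \- T a)%R)%E.
Proof.
move=> Tc; apply/lee_addgt0Pr => e e0.
set W := opnorm _ _.
have W0 : (0 <= W)%E.
  apply: (@le_trans _ _ (lpnorm p (Hop g gamma (fun=> 0) \- T (fun=> 0)))).
    exact: lpnorm_ge0.
  apply: ereal_sup_ubound; exists (fun=> 0) => //=.
  by rewrite (@lpnorm_finsupp _ _ _ 0)// big_geq// powR0 ?lee_fin// invr_neq0// gt_eqF.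
have /opnorm_leP : (W <= W)%E by [].
rewrite -/W; case: W W0 => [w| |]//; last by move=> _ _; rewrite leey.
move=> w0 TW.
have [N TN] := compact_seqtail_small p_gt1 Tc e0.
(* [tailsup N.+1] cuts at [d N], and [N < d N] puts this cut beyond the one where the tails of [T]
   are small. *)
apply: (@le_trans _ _ (tailsup N.+1)); first exact: ereal_inf_lbound.
rewrite -EFinD; apply: tailnorm_le_tailsup; first by rewrite addr_ge0// ltW.
apply: (@matnorm_le_of_opmx _ _ _ _ (fun=> 1) (phase \o g)) => //.
- by rewrite addr_ge0// ltW.
- by move=> _; exact: normc1.
- by move=> k; exact: normc_phase.
- move=> n k; rewrite mulr1 normc_hmat/= /hmat/=; case: ifP => _;
    last by rewrite rmorph0 mulr0.
  exact: scale_phaseE.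
move=> a m am a1; rewrite -seqtail_Hop /=.
apply: (@le_trans _ _ (lpnorm p (fun k => seqtail (d N) (Hop g gamma a \- T a) k
    + seqtail (d N) (T a) k))).
  apply: le_lpnorm => // k _; rewrite /seqtail /=; case: ifP => _; rewrite ?addr0//.
  by rewrite subrK.
apply: le_trans (lpnormD _ _ p_gt1) _; rewrite EFinD; apply: leeD.
  exact: le_trans (le_seqtail_id p_gt1 _ _) (TW _ a1).
by apply: le_trans (TN _ a1); apply: le_seqtail => //; exact/ltnW/block_ge.
Qed.

Lemma tailsup_le_opnorm_Hdual T : compact_on_lp p' T ->
  (ereal_inf (range tailsup) <= opnorm p' (fun a => Hdual g gamma a \- T a)%R)%E.
Proof.
move=> Tc; apply/lee_addgt0Pr => e e0.
set W := opnorm _ _.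
have W0 : (0 <= W)%E.
  apply: (@le_trans _ _ (lpnorm p' (Hdual g gamma (fun=> 0) \- T (fun=> 0)))).
    exact: lpnorm_ge0.
  apply: ereal_sup_ubound; exists (fun=> 0) => //=.
  by rewrite (@lpnorm_finsupp _ _ _ 0)// big_geq// powR0 ?lee_fin// invr_neq0// gt_eqF.
have /opnorm_leP : (W <= W)%E by [].
rewrite -/W; case: W W0 => [w| |]//; last by move=> _ _; rewrite leey.
move=> w0 TW.
have [N TN] := compact_finsupp_small conj_gt1 Tc e0.
apply: (@le_trans _ _ (tailsup N.+1)); first exact: ereal_inf_lbound.
rewrite -EFinD; apply: tailnorm_le_tailsup; first by rewrite addr_ge0// ltW.
apply: (@matnorm_le_tr _ p' p (fun k n => normc (hmat (d N) g gamma n k))).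
(* For the dual the phase of [g k] belongs to the input index, so it is cancelled by rotating the
   input rather than the output. *)
apply: (@matnorm_le_of_opmx _ _ _ _ (fun k => (phase (g k))^-1) (fun=> 1)) => //.
- by rewrite addr_ge0// ltW.
- by move=> k; rewrite normcV normc_phase invr1.
- by move=> _; exact: normc1.
- move=> k n; rewrite mul1r normc_hmat/= /hmat/=; case: ifP => _;
    last by rewrite mul0r rmorph0.
  rewrite scale_phaseE mulrAC mulfV ?mul1r//.
  apply/eqP => ph0; have := normc_phase (g k); rewrite ph0 normc0 => /eqP.
  by rewrite eq_sym oner_eq0.
move=> b m bm b1; rewrite -Hdual_seqtail.
(* The truncated vector is finitely supported and vanishes below [d N > N], so [T bt] is small,
   while [Hdual - T] on it costs at most [w]. *)
set bt := seqtail (d N) b.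
have bt1 : (lpnorm p' bt <= 1)%E by apply: le_trans b1; exact: le_seqtail_id conj_gt1 _ _.
apply: (@le_trans _ _ (lpnorm p' (fun k => (Hdual g gamma bt \- T bt) k + T bt k))).
  by apply: le_lpnorm => // k _ /=; rewrite subrK.
apply: le_trans (lpnormD _ _ conj_gt1) _; rewrite EFinD; apply: leeD; first exact: TW.
apply: (TN _ m) => // k km; first by rewrite /bt /seqtail bm// if_same.
by rewrite /bt /seqtail leqNgt (ltn_trans km (block_ge N)).
Qed.

Lemma essnorm_HopE : essnorm p (Hop g gamma) = ereal_inf (range tailsup).
Proof.
apply/eqP; rewrite eq_le; apply/andP; split.
  by apply: le_ereal_inf_tmp => _ [K _ <-]; exact: essnorm_Hop_le.
by apply: le_ereal_inf_tmp => _ [T Tc <-]; exact: tailsup_le_opnorm_Hop.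
Qed.

Lemma essnorm_HdualE : essnorm p' (Hdual g gamma) = ereal_inf (range tailsup).
Proof.
apply/eqP; rewrite eq_le; apply/andP; split.
  by apply: le_ereal_inf_tmp => _ [K _ <-]; exact: essnorm_Hdual_le.
by apply: le_ereal_inf_tmp => _ [T Tc <-]; exact: tailsup_le_opnorm_Hdual.
Qed.

Lemma tailsup_cvg : tailsup @ \oo --> essnorm p (Hop g gamma).
Proof.
by rewrite essnorm_HopE; apply: ereal_nonincreasing_cvgn; exact: tailsup_noninc.
Qed.

End Fixed.
End EssentialNorm.

(** * The Schur test for the Hilbert kernel *)

Section SchurTest.
Context {R : realType}.

Lemma weighted_amgm (x y t : R) : 0 <= x -> 0 <= y -> 0 < t < 1 ->
  x `^ t * y `^ (1 - t) <= t * x + (1 - t) * y.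
Proof.
move=> x0 y0 /andP[t0 t1]; have t1' : 0 < 1 - t by rewrite subr_gt0.
apply: le_trans (@conjugate_powR _ _ _ t^-1 (1 - t)^-1 _ _ _ _ _) _;
  rewrite ?powR_ge0 ?invr_gt0 ?invrK// ?[t + _]addrC ?subrK//.
by rewrite !powRK ?gt_eqF// [t * x]mulrC [(1 - t) * y]mulrC.
Qed.

Section PowerSums.
Variable al : R.
Hypothesis al01 : 0 < al < 1.
Let al0 : 0 < al. Proof. by case/andP: al01. Qed.
Let al1 : 0 < 1 - al. Proof. by rewrite subr_gt0; case/andP: al01. Qed.

(** A discrete comparison with the integral of [x^(-al)] over [[0, m]]. The increment bound [(1 -
    al) n^(-al) <= n^(1 - al) - (n - 1)^(1 - al)] comes from the weighted AM-GM inequality instead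
    of calculus. *)
Lemma sum_powRN_head m :
  \sum_(1 <= n < m.+1) (n%:R : R) `^ (- al) <= m%:R `^ (1 - al) / (1 - al).
Proof.
elim: m => [|m IH]; first by rewrite big_geq// powR0 ?mul0r// gt_eqF.
rewrite big_nat_recr//=; apply: le_trans (lerD IH (lexx _)) _.
rewrite -lerBrDl -mulrBl ler_pdivlMr//.
set n := (m.+1%:R : R); have n0 : 0 < n by rewrite ltr0n.
have v0 : 0 < n `^ al by rewrite powR_gt0.
have := @weighted_amgm (m%:R) n (1 - al) (ler0n _ _) (ltW n0) _.
rewrite subr_gt0 gtrBl al0 andbC; case/andP: al01 => _ ->/=.
rewrite opprB addrCA subrr addr0 => /(_ isT).
rewrite (_ : m%:R = n - 1 :> R); last by rewrite /n -natr1 addrK.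
set w := (n - 1) `^ (1 - al) => H.
have : w <= (n - (1 - al)) / n `^ al by rewrite ler_pdivlMr//; lra.
rewrite mulrBl powRN [n `^ (1 - al)]powRB; last by rewrite (gt_eqF n0) implybT.
by rewrite powRr1 ?(ltW n0)// => Hw; lra.
Qed.

Lemma powRN_tail_step m : (0 < m)%N ->
  al * (m.+1%:R : R) `^ (- al - 1) <= m%:R `^ (- al) - m.+1%:R `^ (- al).
Proof.
move=> m0; set n := (m.+1%:R : R); have n0 : 0 < n by rewrite ltr0n.
have m0' : 0 < (m%:R : R) by rewrite ltr0n.
have := @weighted_amgm (m%:R) n al (ltW m0') (ltW n0) al01.
set u := m%:R `^ al; have u0 : 0 < u by rewrite powR_gt0.
rewrite powRB; last by rewrite (gt_eqF n0) implybT.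
rewrite powRr1 ?(ltW n0)//; set v := n `^ al; have v0 : 0 < v by rewrite powR_gt0.
rewrite (_ : al * _ + _ = n - al); last by rewrite /n -natr1; lra.
rewrite mulrA ler_pdivrMr// => un.
rewrite [n `^ (- al - 1)]powRB; last by rewrite (gt_eqF n0) implybT.
rewrite !powRN -/u -/v powRr1 ?(ltW n0)//.
have -> : u^-1 - v^-1 = (v - u) / (u * v).
  by field; rewrite !gt_eqF.
rewrite ler_pdivlMr ?mulr_gt0//.
have -> : al * (v^-1 / n) * (u * v) = al * u / n.
  by field; rewrite !gt_eqF.
rewrite ler_pdivrMr//.
(* The right side is [(n^2 - al^2) v]; dropping [al^2 v] and dividing by [n] leaves
   [u (n + al) <= n v], which is the goal cleared of denominators. *)
have : u * n * (n + al) <= (n - al) * v * (n + al).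
  by apply: ler_wpM2r => //; rewrite addr_ge0// ltW.
have : 0 <= al * al * v by rewrite !mulr_ge0// ltW.
move=> aav H; rewrite -(ler_pM2r n0); lra.
Qed.

Lemma sum_powRN_tail k N : (0 < k)%N -> (k < N)%N ->
  \sum_(k.+1 <= n < N) (n%:R : R) `^ (- al - 1) <=
  (k%:R `^ (- al) - N.-1%:R `^ (- al)) / al.
Proof.
move=> k0; elim: N => // N IH; rewrite ltnS leq_eqVlt => /predU1P[<-|kN].
  by rewrite big_geq// subrr mul0r.
rewrite big_nat_recr//=; apply: le_trans (lerD (IH kN) (lexx _)) _.
case: N kN {IH} => // N kN /=.
have := @powRN_tail_step N (leq_trans k0 kN).
rewrite mulrC -ler_pdivlMr// => H.
apply: le_trans (lerD (lexx _) H) _.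
by rewrite -mulrDl addrA subrK.
Qed.

(** The sum is cut at [k]: for [n <= k] the denominator is at least [k], beyond it at least [n]. The
    two parts yield [1 / (1 - al)] and [1 / al]. *)
Lemma sum_hilbert_le k N : (0 < k)%N ->
  \sum_(1 <= n < N) (n%:R : R) `^ (- al) / (n + k)%:R <=
  ((1 - al)^-1 + al^-1) * k%:R `^ (- al).
Proof.
move=> k0; have k0' : 0 < (k%:R : R) by rewrite ltr0n.
pose F n := (n%:R : R) `^ (- al) / (n + k)%:R.
have F0 n : 0 <= F n by rewrite divr_ge0// powR_ge0.
apply: (@le_trans _ _ (\sum_(1 <= n < maxn N k.+1) F n)).
  have [N0|N1] := posnP N; first by rewrite N0 big_geq// sumr_ge0.
  by rewrite [leRHS](big_cat_nat N1 (leq_maxl N k.+1))/= lerDl sumr_ge0.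
set N' := maxn _ _; have kN' : (k.+1 <= N')%N by rewrite leq_maxr.
rewrite (@big_cat_nat _ _ _ k.+1)//= mulrDl lerD//.
  apply: (@le_trans _ _ (\sum_(1 <= n < k.+1) (n%:R : R) `^ (- al) / k%:R)).
    apply: ler_sum => n _; apply: ler_wpM2l; first exact: powR_ge0.
    by rewrite lef_pV2 ?posrE// ?ltr0n ?addn_gt0 ?k0 ?orbT// ler_nat leq_addl.
  rewrite -mulr_suml ler_pdivrMr//; apply: le_trans (sum_powRN_head k) _.
  rewrite addrC powRD ?(gt_eqF k0') ?implybT// powRr1 ?(ltW k0')//.
  by rewrite mulrC mulrA.
apply: (@le_trans _ _ (\sum_(k.+1 <= n < N') (n%:R : R) `^ (- al - 1))).
  rewrite big_nat [leRHS]big_nat; apply: ler_sum => n /andP[kn _].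
  have n0 : 0 < (n%:R : R) by rewrite ltr0n; apply: leq_trans kn.
  rewrite powRB; last by rewrite (gt_eqF n0) implybT.
  rewrite powRr1 ?(ltW n0)//; apply: ler_wpM2l; first exact: powR_ge0.
  by rewrite lef_pV2 ?posrE// ?ltr0n ?addn_gt0 ?k0 ?orbT// ler_nat leq_addr.
apply: le_trans (sum_powRN_tail k0 kN') _.
rewrite mulrC ler_pM2l ?invr_gt0// gerBl powR_ge0//.
Qed.

End PowerSums.

Lemma schur_test (p q : R) (kap : nat -> nat -> R) (u : nat -> R) (C : R) :
  0 < p -> 0 < q -> p^-1 + q^-1 = 1 ->
  (forall n k, 0 <= kap n k) -> (forall n, (0 < n)%N -> 0 < u n) -> 0 <= C ->
  (forall N n, (0 < n)%N ->
    \sum_(1 <= k < N) kap n k * u k `^ (- p) <= C * u n `^ (- p)) ->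
  (forall N k, (0 < k)%N ->
    \sum_(1 <= n < N) kap n k * u n `^ (- q) <= C * u k `^ (- q)) ->
  matnorm_le p q kap C.
Proof.
move=> p0 q0 pq kap0 u0 C0 Hp Hq N f h f0 h0 f1 h1.
pose X := \sum_(1 <= k < N) \sum_(1 <= n < N)
  kap n k * (f n `^ p * u n `^ p * u k `^ (- p) / p).
pose Y := \sum_(1 <= k < N) \sum_(1 <= n < N)
  kap n k * (h k `^ q * u k `^ q * u n `^ (- q) / q).
apply: (@le_trans _ _ (X + Y)).
  rewrite /X /Y -big_split/= big_nat [leRHS]big_nat.
  apply: ler_sum => k /andP[k1 _]; rewrite -big_split/= mulr_suml.
  rewrite [leLHS]big_nat [leRHS]big_nat; apply: ler_sum => n /andP[n1 _].
  rewrite -mulrDr -mulrA; apply: ler_wpM2l => //.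
  have un := u0 n n1; have uk := u0 k k1.
  (* Young's inequality for this factorisation separates [f] from [h]; the two weighted sums are
     then at most [C / p] and [C / q]. *)
  have -> : f n * h k = (f n * u n / u k) * (h k * u k / u n).
    by field; rewrite !gt_eqF.
  apply: le_trans (conjugate_powR _ _ p0 q0 pq) _;
    rewrite ?mulr_ge0 ?invr_ge0 ?(ltW un) ?(ltW uk)//.
  rewrite !powR_div ?mulr_ge0 ?(ltW un) ?(ltW uk)// !powRM ?(ltW un) ?(ltW uk)//.
  by rewrite !powRN.
rewrite -[leRHS]mulr1 -pq mulrDr lerD//.
  rewrite /X exchange_big/=.
  apply: (@le_trans _ _ (\sum_(1 <= n < N) (C * f n `^ p / p))).
    rewrite big_nat [leRHS]big_nat; apply: ler_sum => n /andP[n1 _].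
    have -> : \sum_(1 <= k < N) kap n k * (f n `^ p * u n `^ p * u k `^ (- p) / p)
        = f n `^ p * u n `^ p / p * \sum_(1 <= k < N) kap n k * u k `^ (- p).
      rewrite mulr_sumr; apply: eq_bigr => k _.
      by ring.
    apply: le_trans (ler_wpM2l _ (Hp N n n1)) _.
      by rewrite !mulr_ge0 ?invr_ge0 ?powR_ge0 ?(ltW p0).
    rewrite powRN; have up : u n `^ p != 0 by rewrite gt_eqF// powR_gt0// u0.
    rewrite le_eqVlt; apply/orP; left; apply/eqP.
    by field; rewrite up gt_eqF.
  by rewrite -mulr_suml -mulr_sumr ler_wpM2r ?invr_ge0 ?(ltW p0)// ler_piMr.
apply: (@le_trans _ _ (\sum_(1 <= k < N) (C * h k `^ q / q))).
  rewrite /Y big_nat [leRHS]big_nat; apply: ler_sum => k /andP[k1 _].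
  have -> : \sum_(1 <= n < N) kap n k * (h k `^ q * u k `^ q * u n `^ (- q) / q)
      = h k `^ q * u k `^ q / q * \sum_(1 <= n < N) kap n k * u n `^ (- q).
    rewrite mulr_sumr; apply: eq_bigr => n _.
    by ring.
  apply: le_trans (ler_wpM2l _ (Hq N k k1)) _.
    by rewrite !mulr_ge0 ?invr_ge0 ?powR_ge0 ?(ltW q0).
  rewrite powRN; have up : u k `^ q != 0 by rewrite gt_eqF// powR_gt0// u0.
  rewrite le_eqVlt; apply/orP; left; apply/eqP.
  by field; rewrite up gt_eqF.
by rewrite -mulr_suml -mulr_sumr ler_wpM2r ?invr_ge0 ?(ltW q0)// ler_piMr.
Qed.

End SchurTest.

(** * Lacunary blocks *)

Section LacunaryBlocks.
Context {R : realType}.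

Lemma hkerE (gamma : R) n k :
  hker gamma n k = k%:R `^ gamma * n%:R `^ (- gamma) / (n + k)%:R.
Proof. by rewrite /hker powR_div// powRN. Qed.

(** The Schur weight [n^(1/(pq))] has [-p]-th power [n^(-1/q)] and [-q]-th power [n^(-1/p)]. With
    [al = gamma + 1/p], the two tests become [sum_hilbert_le] with exponents [1 - al] and [al],
    hence the symmetric constant. *)
Lemma hilbert_matnorm_le (p q gamma : R) : 0 < p -> 0 < q -> p^-1 + q^-1 = 1 ->
  - p^-1 < gamma -> gamma < 1 - p^-1 ->
  matnorm_le p q (hker gamma)
    ((1 - (gamma + p^-1))^-1 + (gamma + p^-1)^-1).
Proof.
move=> p0 q0 pq g_gt g_lt; set al := gamma + p^-1.
have al01 : 0 < al < 1 by rewrite /al; apply/andP; split; lra.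
have al01' : 0 < 1 - al < 1 by case/andP: al01 => ? ?; apply/andP; split; lra.
have pn : p != 0 by rewrite gt_eqF.
have qn : q != 0 by rewrite gt_eqF.
have Eq : q^-1 = 1 - p^-1 by rewrite -pq; lra.
have up (n : nat) : ((n%:R : R) `^ (p * q)^-1) `^ (- p) = n%:R `^ (- q^-1).
  by rewrite -powRrM; congr (_ `^ _); field; rewrite pn qn.
have uq (n : nat) : ((n%:R : R) `^ (p * q)^-1) `^ (- q) = n%:R `^ (- p^-1).
  by rewrite -powRrM; congr (_ `^ _); field; rewrite pn qn.
have nD (n : nat) (x y : R) : (0 < n)%N ->
    (n%:R : R) `^ x * n%:R `^ y = n%:R `^ (x + y).
  by move=> n0; rewrite powRD// pnatr_eq0 -lt0n n0 implybT.
apply: (@schur_test _ _ _ _ (fun n => n%:R `^ (p * q)^-1)) => //.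
- by move=> n k; exact: hker_ge0.
- by move=> n n0; rewrite powR_gt0// ltr0n.
- by case/andP: al01 => ? ?; rewrite addr_ge0// invr_ge0 ?subr_ge0 ltW.
- move=> N n n0; rewrite up.
  have -> : \sum_(1 <= k < N) hker gamma n k * (k%:R `^ (p * q)^-1) `^ (- p) =
      n%:R `^ (- gamma) * \sum_(1 <= k < N) k%:R `^ (- (1 - al)) / (k + n)%:R.
    rewrite mulr_sumr; apply: eq_big_nat => k /andP[k0 _]; rewrite up hkerE.
    rewrite (_ : - (1 - al) = gamma + - q^-1) -?nD// 1?addnC;
      last by rewrite /al Eq; ring.
    by ring.
  apply: le_trans (ler_wpM2l (powR_ge0 _ _) (sum_hilbert_le al01' N n0)) _.
  rewrite mulrCA nD// (_ : - gamma + _ = - q^-1); last by rewrite /al Eq; ring.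
  by rewrite (_ : 1 - (1 - al) = al) 1?[al^-1 + _]addrC//; ring.
- move=> N k k0; rewrite uq.
  have -> : \sum_(1 <= n < N) hker gamma n k * (n%:R `^ (p * q)^-1) `^ (- q) =
      k%:R `^ gamma * \sum_(1 <= n < N) n%:R `^ (- al) / (n + k)%:R.
    rewrite mulr_sumr; apply: eq_big_nat => n /andP[n0 _]; rewrite uq hkerE.
    rewrite (_ : - al = - gamma + - p^-1) -?nD//; last by rewrite /al; ring.
    by ring.
  apply: le_trans (ler_wpM2l (powR_ge0 _ _) (sum_hilbert_le al01 N k0)) _.
  by rewrite mulrCA nD// (_ : gamma + - al = - p^-1)// /al; ring.
Qed.

Lemma powR_ratio_le (rho gamma x : R) : 1 <= rho -> rho^-1 <= x -> x <= rho ->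
  x `^ gamma <= rho `^ `|gamma|.
Proof.
move=> rho1 xlo xhi; have rho0 : 0 < rho by apply: lt_le_trans rho1.
have x0 : 0 < x by apply: lt_le_trans xlo; rewrite invr_gt0.
have [g0|g0] := leP 0 gamma.
  by rewrite ger0_norm//; apply: ge0_ler_powR; rewrite ?nnegrE// ltW.
rewrite ltr0_norm//.
rewrite -[x]invrK -powR_inv1 ?invr_ge0 ?(ltW x0)// -powRrM mulN1r.
apply: ge0_ler_powR;
  rewrite ?nnegrE ?oppr_ge0 ?invr_ge0 ?(ltW x0) ?(ltW g0)// ?(ltW rho0)//.
by rewrite -[leRHS]invrK lef_pV2 ?posrE// invr_gt0.
Qed.

(** The power [(k / k')^gamma] costs [rho^|gamma|] for either sign of [gamma], and the quotient
    [(n + k') / (n + k)] costs the other [rho]. *)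
Lemma hker_le_block (rho gamma : R) n k k' : 1 <= rho ->
  (0 < n)%N -> (0 < k)%N -> (0 < k')%N ->
  (k%:R <= rho * k'%:R) -> (k'%:R <= rho * k%:R) ->
  hker gamma n k <= rho `^ `|gamma| * rho * hker gamma n k'.
Proof.
move=> rho1 n0 k0 k'0 kk' k'k; have rho0 : 0 < rho by apply: lt_le_trans rho1.
have n0' : 0 < (n%:R : R) by rewrite ltr0n.
have k0' : 0 < (k%:R : R) by rewrite ltr0n.
have k'0' : 0 < (k'%:R : R) by rewrite ltr0n.
rewrite /hker (_ : k%:R / n%:R = (k%:R / k'%:R) * (k'%:R / n%:R) :> R); last first.
  by field; rewrite !gt_eqF.
rewrite powRM ?divr_ge0//.
rewrite (_ : _ * rho * _ = (rho `^ `|gamma| * (k'%:R / n%:R) `^ gamma) *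
  (rho / (n + k')%:R)); last by ring.
apply: ler_pM; rewrite ?mulr_ge0 ?powR_ge0 ?invr_ge0//.
  apply: ler_wpM2r; first exact: powR_ge0.
  apply: powR_ratio_le => //; last by rewrite ler_pdivrMr.
  by rewrite ler_pdivlMr// ler_pdivrMl.
rewrite -[X in X <= _]mul1r ler_pdivrMr ?ltr0n ?addn_gt0 ?n0//.
rewrite mulrAC ler_pdivlMr ?ltr0n ?addn_gt0 ?n0// mul1r !natrD mulrDr.
by rewrite lerD// ler_peMl// ltW.
Qed.

Section Blocks.
Variables (p q gamma rho : R) (d : nat -> nat) (g : nat -> R[i]).
Hypotheses (p_gt1 : 1 < p) (pq : p^-1 + q^-1 = 1).
Hypotheses (d_incr : forall n, (d n < d n.+1)%N) (d0 : d 0%N = 1%N).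
Hypothesis rho1 : 1 <= rho.

Let p0 : 0 < p. Proof. exact: lt_trans p_gt1. Qed.
Let q0 : 0 < q. Proof. exact: lt_trans (conj_gt1 p_gt1 pq). Qed.
Let rho0 : 0 < rho. Proof. exact: lt_le_trans rho1. Qed.
Let d_gt0 n : (0 < d n)%N. Proof. exact: leq_ltn_trans (block_ge d_incr d0 n). Qed.

Lemma Gmean_ge0 j : 0 <= Gmean p d g j.
Proof. by rewrite mulr_ge0 ?invr_ge0// sumr_ge0// => *; exact: powR_ge0. Qed.

Lemma sum_Gmean j : (0 < j)%N ->
  \sum_(d j.-1 <= k < d j) normc (g k) `^ p = (d j - d j.-1)%:R * Gmean p d g j.
Proof.
case: j => // j _; rewrite /Gmean mulrA mulfV ?mul1r//.
by rewrite pnatr_eq0 -lt0n subn_gt0 d_incr.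
Qed.

Lemma block_ratio j k k' : (0 < j)%N -> (d j)%:R <= rho * (d j.-1)%:R ->
  (d j.-1 <= k < d j)%N -> (d j.-1 <= k' < d j)%N -> (k%:R : R) <= rho * k'%:R.
Proof.
move=> j0 dr /andP[_ kj] /andP[k'j _].
apply: (@le_trans _ _ (d j)%:R); first by rewrite ler_nat ltnW.
by apply: le_trans dr _; rewrite ler_pM2l// ler_nat.
Qed.

(** As [A] varies by at most the factor [C] in the block, each [A k ^ p] is at most [C^p] times the
    block average of [A^p]; what then remains of [g] is its p-th mean. *)
Lemma block_upper j (A : nat -> R) (C s : R) : (0 < j)%N -> 0 <= C -> 0 <= s ->
  (forall k, 0 <= A k) ->
  (forall k k', (d j.-1 <= k < d j)%N -> (d j.-1 <= k' < d j)%N ->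
     A k <= C * A k') ->
  Gmean p d g j `^ p^-1 <= s ->
  \sum_(d j.-1 <= k < d j) (normc (g k) * A k) `^ p <=
  (C * s) `^ p * \sum_(d j.-1 <= k < d j) A k `^ p.
Proof.
move=> j0 C0 s0 A0 AC Gs; set S := \sum_(_ <= k < _) A k `^ p.
have Dj0 : 0 < ((d j - d j.-1)%:R : R).
  by case: (j) j0 => // i _; rewrite ltr0n subn_gt0 d_incr.
have Ak k : (d j.-1 <= k < d j)%N -> A k `^ p <= C `^ p * S / (d j - d j.-1)%:R.
  move=> kj; rewrite ler_pdivlMr// mulr_natr -sumr_const_nat mulr_sumr.
  rewrite big_nat [leRHS]big_nat; apply: ler_sum => k' k'j.
  by rewrite -powRM// powR_leM ?mulr_ge0//; exact: AC.
apply: (@le_trans _ _ (\sum_(d j.-1 <= k < d j)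
    normc (g k) `^ p * (C `^ p * S / (d j - d j.-1)%:R))).
  rewrite big_nat [leRHS]big_nat; apply: ler_sum => k kj.
  by rewrite powRM ?normc_ge0//; apply: ler_wpM2l; [exact: powR_ge0|exact: Ak].
rewrite -mulr_suml sum_Gmean//.
rewrite (_ : _ * _ = Gmean p d g j * (C `^ p * S)); last first.
  by field; rewrite gt_eqF.
rewrite [leRHS](_ : _ = s `^ p * (C `^ p * S)); last by rewrite powRM//; ring.
apply: ler_wpM2r.
  by rewrite mulr_ge0 ?powR_ge0// sumr_ge0// => *; exact: powR_ge0.
by rewrite -(@powRVK _ p (Gmean _ _ _ _)) ?gt_eqF ?Gmean_ge0// powR_leM ?powR_ge0.
Qed.

Lemma tailnorm_le_Gmean K (C s : R) : 0 <= C -> 0 <= s ->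
  matnorm_le p q (hker gamma) C -> (0 < K)%N ->
  (forall j, (K <= j)%N -> (d j)%:R <= rho * (d j.-1)%:R) ->
  (forall j, (K <= j)%N -> Gmean p d g j `^ p^-1 <= s) ->
  tailnorm_le p q gamma g (d K.-1) (rho `^ `|gamma| * rho * s * C).
Proof.
move=> C0 s0 hC K0 dK GK; set B := rho `^ `|gamma| * rho.
have B0 : 0 <= B by rewrite mulr_ge0 ?powR_ge0// ltW.
have BsC0 : 0 <= B * s * C by apply: mulr_ge0 => //; exact: mulr_ge0.
apply: (matnorm_le_of_image p0 q0 pq _ BsC0) => [n k|N f f0 f1].
  exact: normc_ge0.
(* Extension by zero allows the square section to be enlarged from [N] to the block boundary
   [d J >= N], so that only whole blocks occur. *)
pose f' n := if (n < N)%N then f n else 0.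
have f'0 n : 0 <= f' n by rewrite /f'; case: ifP.
have dmono := block_homo d_incr.
have sumf' (F : nat -> R -> R) N' : (N <= N')%N -> (forall n, F n 0 = 0) ->
    \sum_(1 <= n < N') F n (f' n) = \sum_(1 <= n < N) F n (f n).
  move=> NN' F0; have [N0|N1] := posnP N.
    by rewrite [RHS]big_geq ?N0// big1// => n _; rewrite /f' N0/= F0.
  rewrite (big_cat_nat N1 NN')/= [X in _ + X]big_nat [X in _ + X]big1 ?addr0.
    by apply: eq_big_nat => n /andP[_ nN]; rewrite /f' nN.
  by move=> n /andP[Nn _]; rewrite /f' ltnNge Nn/= F0.
pose J := (K.-1 + N)%N.
have NJ : (N <= d J)%N.
  by apply: leq_trans (ltnW (block_ge d_incr d0 J)); rewrite leq_addl.
have KJ : (K.-1 <= J)%N by rewrite leq_addr.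
pose A k := \sum_(1 <= n < d J) hker gamma n k * f' n.
have A0 k : 0 <= A k by rewrite sumr_ge0// => *; rewrite mulr_ge0 ?hker_ge0.
have AC : \sum_(1 <= k < d J) A k `^ p <= C `^ p.
  apply: (matnorm_le_image p0 q0 pq _ C0 hC) => // [*|]; first exact: hker_ge0.
  by rewrite (sumf' (fun _ x => x `^ p))// => _; rewrite powR0 ?gt_eqF.
have blocks m : \sum_(d K.-1 <= k < d (K.-1 + m)) (normc (g k) * A k) `^ p <=
    (B * s) `^ p * \sum_(d K.-1 <= k < d (K.-1 + m)) A k `^ p.
  elim: m => [|m IH]; first by rewrite addn0 !big_geq// mulr0.
  have h1 : (d K.-1 <= d (K.-1 + m))%N by rewrite dmono// leq_addr.
  have h2 : (d (K.-1 + m) <= d (K.-1 + m.+1))%N by rewrite dmono// leq_add2l.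
  rewrite (big_cat_nat h1 h2)/= [X in _ <= _ * X](big_cat_nat h1 h2)/= mulrDr.
  apply: lerD => //; rewrite addnS.
  apply: (@block_upper (K.-1 + m).+1) => // [k k' kj k'j|]; last first.
    by apply: GK; rewrite -addSn prednK// leq_addr.
  rewrite /A mulr_sumr big_nat [leRHS]big_nat; apply: ler_sum => n /andP[n1 _].
  rewrite mulrA; apply: ler_wpM2r => //.
  have dj : (d (K.-1 + m).+1)%:R <= rho * (d (K.-1 + m).+1.-1)%:R.
    by apply: dK; rewrite -addSn prednK// leq_addr.
  have k0 x : (d (K.-1 + m).+1.-1 <= x < d (K.-1 + m).+1)%N -> (0 < x)%N.
    by case/andP => + _; apply: leq_trans; exact: d_gt0.
  apply: hker_le_block => //; [exact: k0 kj|exact: k0 k'j| |].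
    exact: (block_ratio _ dj kj k'j).
  exact: (block_ratio _ dj k'j kj).
have gA k : (\sum_(1 <= n < N) normc (hmat (d K.-1) g gamma n k) * f n) =
    if (d K.-1 <= k)%N then normc (g k) * A k else 0.
  case: ifPn => dk; last first.
    by rewrite big1// => n _; rewrite normc_hmat (negbTE dk) mul0r.
  rewrite /A (sumf' (fun n x => hker gamma n k * x))//; last by move=> n; rewrite mulr0.
  by rewrite mulr_sumr; apply: eq_bigr => n _; rewrite normc_hmat dk; ring.
apply: (@le_trans _ _ (\sum_(d K.-1 <= k < d J) (normc (g k) * A k) `^ p)).
  apply: (@le_trans _ _ (\sum_(1 <= k < d J)
      (if (d K.-1 <= k)%N then normc (g k) * A k else 0) `^ p)).
    under eq_bigr do rewrite gA.
    have [N0|N1] := posnP N.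
      by rewrite N0 [leLHS]big_geq// sumr_ge0// => *; exact: powR_ge0.
    rewrite [leRHS](big_cat_nat N1 NJ)/= lerDl sumr_ge0// => *; exact: powR_ge0.
  rewrite (big_cat_nat (d_gt0 K.-1) (dmono _ _ KJ))/=.
  rewrite [X in X + _]big_nat big1 ?add0r.
    by rewrite big_nat [leRHS]big_nat; apply: ler_sum => k /andP[-> _].
  by move=> k /andP[_ kd]; rewrite leqNgt kd powR0// gt_eqF.
apply: le_trans (blocks N) _; rewrite [leRHS]powRM ?(mulr_ge0 B0 s0)//.
apply: ler_wpM2l; first exact: powR_ge0.
apply: le_trans AC; rewrite [leRHS](big_cat_nat (d_gt0 K.-1) (dmono _ _ KJ))/=.
by rewrite lerDr sumr_ge0// => *; exact: powR_ge0.
Qed.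

(** Within the block the kernel is at least [rho^(-|gamma|) / (2 d_j)], because [n + k <= 2 d_j].
    Summing over the [D] columns of the block gives the factor [D / d_j >= 1 - 1/r]. *)
Lemma Gmean_le_tailnorm K (M r : R) j : 0 <= M -> 1 < r ->
  tailnorm_le p q gamma g (d K.-1) M -> (K <= j)%N -> (0 < j)%N ->
  (d j)%:R <= rho * (d j.-1)%:R -> r * (d j.-1)%:R <= (d j)%:R ->
  (rho `^ `|gamma|)^-1 / 2 * (1 - r^-1) * Gmean p d g j `^ p^-1 <= M.
Proof.
move=> M0 r1 gM Kj j0 dj rj.
set c0 := (rho `^ `|gamma|)^-1 / 2.
have rg0 : 0 < rho `^ `|gamma| by rewrite powR_gt0.
have c00 : 0 < c0 by rewrite divr_gt0 ?invr_gt0.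
have r0 : 0 < r by apply: lt_trans r1.
have t0 : 0 <= 1 - r^-1 by rewrite subr_ge0 invf_le1// ltW.
have dj_lt : (d j.-1 < d j)%N by case: (j) j0 => // i _; exact: d_incr.
pose D : R := (d j - d j.-1)%:R.
have D0 : 0 < D by rewrite ltr0n subn_gt0.
have dj0 : 0 < ((d j)%:R : R) by rewrite ltr0n.
have Dd : 1 - r^-1 <= D / (d j)%:R.
  rewrite ler_pdivlMr// /D natrB ?(ltnW dj_lt)// mulrBl mul1r lerB//.
  by rewrite ler_pdivlMl.
(* No upper cut is needed: all sums below stop at [d j]. *)
pose f n := if (d j.-1 <= n)%N then D `^ (- p^-1) else 0 : R.
have f0 n : 0 <= f n by rewrite /f; case: ifP => // _; exact: powR_ge0.
have d1 := d_gt0 j.-1.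
have f1 : \sum_(1 <= n < d j) f n `^ p <= 1.
  rewrite (big_cat_nat d1 (ltnW dj_lt))/= [X in X + _]big_nat big1 ?add0r; last first.
    by move=> n /andP[_ nd]; rewrite /f leqNgt nd powR0// gt_eqF.
  rewrite (@eq_big_nat _ _ _ _ _ _ (fun=> D^-1)) => [|n /andP[dn _]]; last first.
    rewrite /f dn -powRrM mulNr mulVf ?gt_eqF// powR_inv1// ltW.
  by rewrite sumr_const_nat -[_ *+ _]mulr_natl mulfV// gt_eqF.
have normc0' n k : 0 <= normc (hmat (d K.-1) g gamma n k) by exact: normc_ge0.
have := matnorm_le_image p0 q0 pq normc0' M0 gM f0 f1.
have Hk k : (d j.-1 <= k < d j)%N ->
    normc (g k) * (c0 * (1 - r^-1) * D `^ (- p^-1)) <=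
    \sum_(1 <= n < d j) normc (hmat (d K.-1) g gamma n k) * f n.
  move=> kj; have [dk kd] := andP kj.
  have Kk : (d K.-1 <= k)%N.
    by apply: leq_trans dk; apply: (block_homo d_incr); rewrite -!subn1 leq_sub2r.
  rewrite (big_cat_nat d1 (ltnW dj_lt))/=.
  apply: (@le_trans _ _ (\sum_(d j.-1 <= n < d j)
      normc (hmat (d K.-1) g gamma n k) * f n)); last first.
    by rewrite lerDr sumr_ge0// => *; rewrite mulr_ge0.
  apply: (@le_trans _ _ (\sum_(d j.-1 <= n < d j)
      (normc (g k) * (c0 / (d j)%:R * D `^ (- p^-1))))).
    rewrite sumr_const_nat -[_ *+ _]mulr_natl -/D.
    rewrite [leRHS](_ : _ = normc (g k) * (c0 * (D / (d j)%:R) * D `^ (- p^-1))).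
      apply: ler_wpM2l; first exact: normc_ge0.
      by apply: ler_wpM2r; rewrite ?powR_ge0// ler_pM2l.
    by ring.
  rewrite big_nat [leRHS]big_nat; apply: ler_sum => n nj; have [dn nd] := andP nj.
  rewrite /f dn normc_hmat Kk mulrA ler_wpM2r ?powR_ge0//.
  rewrite mulrC ler_wpM2r ?normc_ge0//.
  have n0 : 0 < (n%:R : R) by rewrite ltr0n; apply: leq_trans dn.
  have k0 : 0 < (k%:R : R) by rewrite ltr0n; apply: leq_trans dk.
  rewrite /hker /c0 -mulrA -invfM; apply: ler_pM; rewrite ?invr_ge0 ?mulr_ge0 ?powR_ge0//.
    have -> : (k%:R / n%:R : R) `^ gamma = ((n%:R / k%:R) `^ gamma)^-1.
      by rewrite !powR_div// invf_div.
    rewrite lef_pV2 ?posrE ?powR_gt0 ?divr_gt0//; apply: powR_ratio_le => //.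
      by rewrite ler_pdivlMr// ler_pdivrMl//; exact: block_ratio dj kj nj.
    by rewrite ler_pdivrMr//; exact: block_ratio dj nj kj.
  rewrite lef_pV2 ?posrE ?mulr_gt0 ?ltr0n ?addn_gt0 ?(leq_trans d1 dn)//.
  by rewrite natrD mulr_natl mulr2n lerD// ler_nat ltnW.
move=> HM.
have c1 : 0 <= c0 * (1 - r^-1) by rewrite mulr_ge0// ltW.
have : (c0 * (1 - r^-1)) `^ p * Gmean p d g j <= M `^ p.
  apply: le_trans HM; rewrite (big_cat_nat d1 (ltnW dj_lt))/=.
  apply: (@le_trans _ _ (\sum_(d j.-1 <= k < d j)
      (normc (g k) * (c0 * (1 - r^-1) * D `^ (- p^-1))) `^ p)); last first.
    rewrite ler_wpDl ?sumr_ge0// => [*|]; first exact: powR_ge0.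
    rewrite [leLHS]big_nat [leRHS]big_nat; apply: ler_sum => k kj.
    rewrite powR_leM//; first exact: Hk.
      apply: mulr_ge0; first exact: normc_ge0.
      by apply: mulr_ge0; rewrite ?powR_ge0.
    by rewrite sumr_ge0// => *; rewrite mulr_ge0.
  rewrite (eq_bigr (fun k => normc (g k) `^ p * ((c0 * (1 - r^-1)) `^ p / D))); last first.
    move=> k _; rewrite powRM ?normc_ge0//; last by rewrite mulr_ge0// powR_ge0.
    rewrite [(c0 * _ * _) `^ p]powRM ?powR_ge0//.
    congr (_ * (_ * _)); rewrite -powRrM mulNr mulVf ?gt_eqF// powR_inv1// ltW.
  rewrite -mulr_suml /Gmean -/D; set S := \sum_(_ <= _ < _) _.
  by rewrite [leLHS]mulrA [leLHS]mulrC.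
rewrite -{1}(@powRVK _ p (Gmean _ _ _ _)) ?gt_eqF ?Gmean_ge0//.
rewrite -powRM ?powR_ge0// powR_leM//.
by rewrite mulr_ge0// powR_ge0.
Qed.

End Blocks.
End LacunaryBlocks.

(** * Upper and lower limits through tail suprema and infima *)

Section LimSup.
Context {R : realType}.

Lemma limn_esupE (u : (\bar R)^nat) : limn_esup u = ereal_inf (range (esups u)).
Proof. by rewrite limn_esup_lim; apply/cvg_lim => //; exact: cvg_esups_inf. Qed.

Lemma limn_einfE (u : (\bar R)^nat) : limn_einf u = ereal_sup (range (einfs u)).
Proof. by rewrite limn_einf_lim; apply/cvg_lim => //; exact: cvg_einfs_sup. Qed.

Lemma limn_esup_le (u : (\bar R)^nat) n (x : \bar R) :
  (forall j, (n <= j)%N -> (u j <= x)%E) -> (limn_esup u <= x)%E.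
Proof.
move=> ux; rewrite limn_esupE; apply: (@le_trans _ _ (esups u n)).
  by apply: ereal_inf_lbound; exists n.
by apply: ge_ereal_sup => _ [j nj <-]; exact: ux.
Qed.

(** The witness is itself a tail supremum: it is finite, being below [x] and above a real value of
    [v]. *)
Lemma limn_esup_lt (v : nat -> R) (x : \bar R) :
  (limn_esup (fun j => (v j)%:E) < x)%E ->
  exists2 rho : R, (rho%:E < x)%E & exists n, forall j, (n <= j)%N -> v j <= rho.
Proof.
rewrite limn_esupE => /ereal_inf_lt[_ [n _ <-] nx].
have vn j : (n <= j)%N -> ((v j)%:E <= esups (fun j => (v j)%:E) n)%E.
  by move=> nj; apply: ereal_sup_ubound; exists j.
case: (esups _ _) nx vn => [rho| |] nx vn.
- by exists rho => //; exists n => j /vn; rewrite lee_fin.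
- by move: nx; rewrite ltNge leey.
- by have := vn n (leqnn n); rewrite leeNy_eq.
Qed.

Lemma limn_einf_gt (v : nat -> R) (x : \bar R) :
  (x < limn_einf (fun j => (v j)%:E))%E ->
  exists2 r : R, (x < r%:E)%E & exists n, forall j, (n <= j)%N -> r <= v j.
Proof.
rewrite limn_einfE => /ereal_sup_gt[_ [n _ <-] nx].
have vn j : (n <= j)%N -> (einfs (fun j => (v j)%:E) n <= (v j)%:E)%E.
  by move=> nj; apply: ereal_inf_lbound; exists j.
case: (einfs _ _) nx vn => [r| |] nx vn.
- by exists r => //; exists n => j /vn; rewrite lee_fin.
- by have := vn n (leqnn n); rewrite leye_eq.
- by move: nx; rewrite ltNge leNye.
Qed.

End LimSup.

Theorem theorem3 (R : realType) (p p' gamma : R) (d : nat -> nat)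
    (p_gt1 : 1 < p) (conj_pp' : p^-1 + p'^-1 = 1)
    (gamma_gt : - p^-1 < gamma) (gamma_lt : gamma < 1 - p^-1)
    (d_incr : forall n, (d n < d n.+1)%N) (d0 : d 0%N = 1%N) :
  (forall g : nat -> R[i], bounded_on_lp p (Hop g gamma) ->
     essnorm p (Hop g gamma) = essnorm p' (Hdual g gamma) /\
     (fun K => ereal_sup [set Ctail p gamma d K (absseq g) a
                         | a in [set a | lpnorm p a = 1%E]]) @ \oo
       --> essnorm p (Hop g gamma)) /\
  ((1 < limn_einf (fun j => ((d j)%:R / (d j.-1)%:R : R)%:E))%E ->
   (limn_esup (fun j => ((d j)%:R / (d j.-1)%:R : R)%:E) < +oo)%E ->
   exists c C : R, [/\ 0 < c, 0 < C &
     forall g : nat -> R[i], bounded_on_lp p (Hop g gamma) ->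
       let L := limn_esup (fun j => (Gmean p d g j `^ p^-1)%:E) in
       [/\ essnorm p (Hop g gamma) = essnorm p' (Hdual g gamma),
           (c%:E * L <= essnorm p (Hop g gamma))%E &
           (essnorm p (Hop g gamma) <= C%:E * L)%E]]).
Proof.
have p0 : 0 < p by apply: lt_trans p_gt1.
have p'0 : 0 < p' by apply: lt_trans (conj_gt1 p_gt1 conj_pp').
have essE (g : nat -> R[i]) : bounded_on_lp p (Hop g gamma) ->
    essnorm p (Hop g gamma) = essnorm p' (Hdual g gamma).
  move=> Hg; rewrite (essnorm_HopE p_gt1 conj_pp' d_incr d0 Hg).
  by rewrite (essnorm_HdualE p_gt1 conj_pp' d_incr d0 Hg).
split.
  move=> g Hg; split; first exact: essE.
  exact: (tailsup_cvg p_gt1 conj_pp' d_incr d0 Hg).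
have d_gt0 n : 0 < ((d n)%:R : R).
  by rewrite ltr0n; exact: leq_ltn_trans (block_ge d_incr d0 n).
move=> /limn_einf_gt[r r1 [n1 Hn1]] /limn_esup_lt[rho _ [n2 Hn2]].
rewrite lte_fin in r1.
have {}Hn1 j : (n1 <= j)%N -> r * (d j.-1)%:R <= (d j)%:R.
  by move/Hn1; rewrite ler_pdivlMr.
have rho1 : 1 <= rho.
  apply: le_trans (Hn2 _ (leqnn n2)).
  by rewrite ler_pdivlMr// mul1r ler_nat (block_homo d_incr)// leq_pred.
have {}Hn2 j : (n2 <= j)%N -> (d j)%:R <= rho * (d j.-1)%:R.
  by move/Hn2; rewrite ler_pdivrMr.
have rho0 : 0 < rho by apply: lt_le_trans rho1.
have rg0 : 0 < rho `^ `|gamma| by rewrite powR_gt0.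
(* [c] is the factor of [Gmean_le_tailnorm]; [Cs] is the Schur bound of the kernel and
   [rho^|gamma| * rho] its oscillation in a block. All are fixed before [g]. *)
pose c := (rho `^ `|gamma|)^-1 / 2 * (1 - r^-1).
pose Cs := (1 - (gamma + p^-1))^-1 + (gamma + p^-1)^-1.
pose C := rho `^ `|gamma| * rho * Cs.
have c0 : 0 < c.
  rewrite mulr_gt0 ?divr_gt0 ?invr_gt0// subr_gt0 invf_lt1//.
  exact: lt_trans r1.
have Cs0 : 0 < Cs by rewrite addr_gt0// invr_gt0; lra.
have C0 : 0 < C by rewrite !mulr_gt0.
exists c, C; split; [exact: c0|exact: C0|move=> g Hg L].
split; first exact: essE.
- rewrite (essnorm_HopE p_gt1 conj_pp' d_incr d0 Hg).
  apply: le_ereal_inf_tmp => _ [K _ <-].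
  have [M M0 EM] := tailsup_fin p_gt1 conj_pp' d_incr d0 Hg K.
  have gM : tailnorm_le p p' gamma g (d K.-1) M.
    by apply: (tailsup_tailnorm_le p_gt1 conj_pp' d_incr d0) => //; rewrite EM.
  (* The last [1] excludes [j = 0], whose block is empty. *)
  rewrite EM -lee_pdivlMl//; apply: (@limn_esup_le _ _ (maxn K (maxn n1 (maxn n2 1)))).
  move=> j; rewrite !geq_max => /and4P[Kj n1j n2j j1].
  rewrite lee_fin ler_pdivlMl//.
  exact: (Gmean_le_tailnorm p_gt1 conj_pp' d_incr d0 rho1 M0 r1 gM Kj j1
    (Hn2 _ n2j) (Hn1 _ n1j)).
have L0 : (0 <= L)%E.
  rewrite /L limn_esupE; apply: le_ereal_inf_tmp => _ [n _ <-].
  apply: (@le_trans _ _ (Gmean p d g n `^ p^-1)%:E); first by rewrite lee_fin powR_ge0.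
  by apply: ereal_sup_ubound; exists n => //=.
case EL : L L0 => [l| |]// l0; last by rewrite gt0_muley ?leey// lte_fin.
apply/lee_addgt0Pr => e e0.
(* The slack [e / C] becomes [e] after multiplication by [C]. *)
have : (L < (l + e / C)%:E)%E by rewrite EL lte_fin ltrDl divr_gt0.
move=> /limn_esup_lt[s sl [n Hn]].
pose K := maxn n (maxn n2 1).
have s0 : 0 <= s by apply: le_trans (Hn n (leqnn n)); exact: powR_ge0.
have hC := hilbert_matnorm_le p0 p'0 conj_pp' gamma_gt gamma_lt.
have K0 : (0 < K)%N by rewrite !leq_max/= !orbT.
have HK j : (K <= j)%N -> (n <= j)%N /\ (n2 <= j)%N.
  by rewrite !geq_max => /and3P[? ? _].
have := tailnorm_le_Gmean p_gt1 conj_pp' d_incr d0 rho1 (ltW Cs0) s0 hC.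
move=> /(_ g K K0).
move=> /(_ (fun j Kj => Hn2 j (HK j Kj).2) (fun j Kj => Hn j (HK j Kj).1)) gK.
apply: le_trans (essnorm_Hop_le p_gt1 conj_pp' d_incr d0 Hg K) _.
apply: (@le_trans _ _ (C * s)%:E).
  rewrite (_ : C * s = rho `^ `|gamma| * rho * s * Cs); last by rewrite /C; ring.
  apply: (tailnorm_le_tailsup p_gt1 conj_pp' d_incr d0 _ gK).
  by rewrite !mulr_ge0// ltW.
rewrite -EFinM -EFinD lee_fin; move: sl; rewrite lte_fin => /ltW sl.
apply: le_trans (ler_wpM2l (ltW C0) sl) _.
by rewrite mulrDr mulrCA mulfV ?gt_eqF// mulr1.
Qed.
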